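(* Let $i\in I$. (1) $U_i$ is a left $U_q(\mathfrak p_i)$-module by $$f_i\cdot u=\mathrm{ad}_{f_i}(u),\quad e_i\cdot u=\mathrm{ad}_{e_i}(u),\quad f_j\cdot u=f_ju\ (j\ne i),\quad q^h\cdot u=q^huq^{-h}\ (h\in\mathsf P^\vee).$$ Furthermore, the isomorphism $U_i\to V_i(0)$, $u\mapsto uv_0$, is left $U_q(\mathfrak p_i)$-linear. (2) ${}_iU$ is a right $U_q(\mathfrak p_i)$-module by $$u\cdot f_i=\mathrm{ad}^*_{f_i}(u),\quad u\cdot e_i=\mathrm{ad}^*_{e_i}(u),\quad u\cdot f_j=uf_j\ (j\ne i),\quad u\cdot q^h=q^{-h}uq^h\ (h\in\mathsf P^\vee).$$ Furthermore, the isomorphism ${}_iU\to{}_iV(0)$, $u\mapsto v_0u$, is right $U_q(\mathfrak p_i)$-linear.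
   Context: $\mathsf A=(a_{i,j})_{i,j\in I}$ is a symmetrizable generalized Cartan matrix; $\mathsf P$ is a free abelian group, $\{\alpha_i\}\subset\mathsf P$ linearly independent, $\{h_i\}\subset\mathsf P^\vee=\mathrm{Hom}_{\mathbb Z}(\mathsf P,\mathbb Z)$, $(\cdot,\cdot)$ a symmetric $\mathbb Q$-valued bilinear form on $\mathsf P$, with $\langle h_i,\alpha_j\rangle=a_{i,j}$, $(\alpha_i,\alpha_i)\in2\mathbb Z_{>0}$, $\langle h_i,\lambda\rangle=2(\alpha_i,\lambda)/(\alpha_i,\alpha_i)$, and there exist $\Lambda_i\in\mathsf P$ with $\langle h_j,\Lambda_i\rangle=\delta_{i,j}$. $q_i=q^{(\alpha_i,\alpha_i)/2}$, $s_ih=h-\langle h,\alpha_i\rangle h_i$, $[n]_i=(q_i^n-q_i^{-n})/(q_i-q_i^{-1})$, $[n]_i!=[n]_i\cdots[1]_i$, $z_i^{(s)}=z_i^s/[s]_i!$. $U_q(\mathfrak g)$ is the $\mathbb Q(q)$-algebra generated by $e_i,f_i$ ($i\in I$), $q^h$ ($h\in\mathsf P^\vee$) with $q^0=1$, $q^hq^k=q^{h+k}$, $q^he_iq^{-h}=q^{\langle h,\alpha_i\rangle}e_i$, $q^hf_iq^{-h}=q^{-\langle h,\alpha_i\rangle}f_i$, $[e_i,f_j]=\delta_{i,j}(t_i-t_i^{-1})/(q_i-q_i^{-1})$, $t_i=q^{\frac{(\alpha_i,\alpha_i)}2h_i}$, and $\sum_{s=0}^{1-a_{i,j}}(-1)^sz_i^{(s)}z_jz_i^{(1-a_{i,j}-s)}=0$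 ($i\ne j$, $z=e,f$). $U_q^-(\mathfrak g)$ is the subalgebra generated by the $f_j$. $U_q(\mathfrak p_i)$ is the subalgebra of $U_q(\mathfrak g)$ generated by $e_i$, $f_j$ ($j\in I$), $q^h$ (equivalently, the algebra on these generators with the relations $q^0=1$, $q^hq^k=q^{h+k}$, $q^he_iq^{-h}=q^{\langle h,\alpha_i\rangle}e_i$, $q^hf_jq^{-h}=q^{-\langle h,\alpha_j\rangle}f_j$ ($j\in I$), $[e_i,f_j]=\delta_{i,j}(t_i-t_i^{-1})/(q_i-q_i^{-1})$ ($j\in I$), and $\sum_{s=0}^{1-a_{j,k}}(-1)^sf_j^{(s)}f_kf_j^{(1-a_{j,k}-s)}=0$ ($j,k\in I$, $j\ne k$)). $T_i$ is the automorphism of $U_q(\mathfrak g)$ with $T_i(q^h)=q^{s_ih}$, $T_i(e_i)=-t_i^{-1}f_i$, $T_i(f_i)=-e_it_i$, $T_i(e_j)=\sum_{r+s=-a_{i,j}}(-1)^rq_i^{-r}e_i^{(r)}e_je_i^{(s)}$, $T_i(f_j)=\sum_{r+s=-a_{i,j}}(-1)^rq_i^rf_i^{(s)}f_jf_i^{(r)}$ ($j\ne i$). $U_i=U_q^-(\mathfrak g)\cap T_iU_q^-(\mathfrak g)$, ${}_iU=U_q^-(\mathfrak g)\cap T_i^{-1}U_q^-(\mathfrak g)$. $\mathrm{ad}_{f_i}(u)=f_iu-t_iut_i^{-1}f_i$, $\mathrm{ad}_{e_i}(u)=e_iut_i-ue_it_i$, $\mathrm{ad}^*_{f_i}(u)=uf_i-f_it_iut_i^{-1}$,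 $\mathrm{ad}^*_{e_i}(u)=t_i^{-1}ue_i-t_i^{-1}e_iu$ (endomorphisms of $U_q(\mathfrak g)$). $V_i(0)=U_q(\mathfrak p_i)/\big(U_q(\mathfrak p_i)e_i+U_q(\mathfrak p_i)f_i+\sum_hU_q(\mathfrak p_i)(q^h-1)\big)$ and ${}_iV(0)=U_q(\mathfrak p_i)/\big(e_iU_q(\mathfrak p_i)+f_iU_q(\mathfrak p_i)+\sum_h(q^h-1)U_q(\mathfrak p_i)\big)$; $v_0$ denotes the image of $1$ in each. The maps $u\mapsto uv_0$ and $u\mapsto v_0u$ in the statement are linear isomorphisms. *)

(* Defs.v *)
From HB Require Import structures.
From mathcomp Require Import all_boot all_order all_algebra.
From mathcomp Require Import boolp.
From mathcomp.multinomials Require Import monalg.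

Set Implicit Arguments.
Unset Strict Implicit.
Unset Printing Implicit Defensive.

Import GRing.Theory.
Local Open Scope ring_scope.
Local Open Scope quotient_scope.

Section Dual.
Variable P : zmodType.

Definition dual : Type := {additive P -> int}.

HB.instance Definition _ := gen_eqMixin dual.
HB.instance Definition _ := gen_choiceMixin dual.

Definition dual_fun (f : dual) : P -> int := f : {additive P -> int}.
Coercion dual_fun : dual >-> Funclass.

Lemma dualP (f g : dual) : f =1 g -> f = g.
Proof.
case: f => f [[cf]]; case: g => g [[cg]] fg.
have efg : f = g by apply/funext.
by case: _ / efg in cg fg *; rewrite (Prop_irrelevance cf cg).
Qed.

Definition dual0 : dual := GRing.null_fun int : {additive P -> int}.
Definition dualD (f g : dual) : dual :=
  GRing.add_fun (f : {additive P -> int}) (g : {additive P -> int})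
    : {additive P -> int}.
Definition dualN (f : dual) : dual :=
  GRing.opp_fun (f : {additive P -> int}) : {additive P -> int}.

Fact dualDA : associative dualD.
Proof. by move=> f g h; apply: dualP => x; exact: addrA. Qed.
Fact dualDC : commutative dualD.
Proof. by move=> f g; apply: dualP => x; exact: addrC. Qed.
Fact dual0D : left_id dual0 dualD.
Proof. by move=> f; apply: dualP => x; exact: add0r. Qed.
Fact dualND : left_inverse dual0 dualN dualD.
Proof. by move=> f; apply: dualP => x; exact: addNr. Qed.

HB.instance Definition _ :=
  GRing.isZmodule.Build dual dualDA dualDC dual0D dualND.

End Dual.

Definition lin_indep (J : choiceType) (P : zmodType) (b : J -> P) : Prop :=
  forall (s : seq J) (c : J -> int), uniq s ->
    \sum_(j <- s) b j *~ c j = 0 -> forall j, j \in s -> c j = 0.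

Definition free_abelian (P : zmodType) : Prop :=
  exists (J : choiceType) (b : J -> P), lin_indep b /\
    forall x, exists (s : seq J) (c : J -> int), x = \sum_(j <- s) b j *~ c j.

Record gen_cartan_matrix (I : Type) (a : I -> I -> int) : Prop := {
  gcm_diag : forall i, a i i = 2;
  gcm_offdiag : forall i j, i <> j -> a i j <= 0;
  gcm_zero : forall i j, a i j = 0 -> a j i = 0
}.

Definition symmetrizable (I : Type) (a : I -> I -> int) : Prop :=
  exists d : I -> rat, (forall i, 0 < d i) /\
    forall i j, d i * (a i j)%:~R = d j * (a j i)%:~R.

Record cartan_datum (I : choiceType) (P : zmodType) := CartanDatum {
  cartan : I -> I -> int;
  alpha : I -> P;
  coroot : I -> dual P;
  bilform : P -> P -> rat;
  cartan_gcm : gen_cartan_matrix cartan;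
  cartan_symm : symmetrizable cartan;
  weight_free : free_abelian P;
  alpha_indep : lin_indep alpha;
  form_sym : forall x y, bilform x y = bilform y x;
  form_add : forall x y z, bilform (x + y) z = bilform x z + bilform y z;
  coroot_alpha : forall i j, coroot i (alpha j) = cartan i j;
  form_alpha : forall i, exists2 m : nat, (0 < m)%N &
                 bilform (alpha i) (alpha i) = (2 * m)%:R;
  coroot_form : forall i x, (coroot i x)%:~R =
                 2 * bilform (alpha i) x / bilform (alpha i) (alpha i);
  fund_weight : forall i, exists L : P, forall j, coroot j L = (i == j)%:R
}.

Section QuotientModule.
Variables (F : fieldType) (V : lmodType F) (J : submodClosed V).

(* [submodClosed] does not carry the [zmodClosed] structure [Quotient.quot]
   asks for. *)
Definition as_zmod : {pred V} := fun x => x \in J.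

Fact as_zmod_closed : GRing.zmod_closed as_zmod.
Proof.
split=> [|x y xJ yJ]; first exact: rpred0.
by rewrite unfold_in -scaleN1r rpredD // rpredZ.
Qed.
HB.instance Definition _ := GRing.isZmodClosed.Build V as_zmod as_zmod_closed.

Definition lquot : Type := Quotient.quot as_zmod.
HB.instance Definition _ := GRing.Zmodule.on lquot.

End QuotientModule.

(* [lpi], [Uq_mul] and [frvar] are locked so that comparing distinct elements up
   to conversion does not unfold the underlying monoid algebra. *)
HB.lock Definition lpi (F : fieldType) (V : lmodType F) (J : submodClosed V)
  (x : V) : lquot J := \pi_(Quotient.quot (as_zmod J)) x.

Section QuotientModuleTheory.
Variables (F : fieldType) (V : lmodType F) (J : submodClosed V).
Notation lquot := (lquot J).
Notation lpi := (@lpi F V J).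

Lemma lpi_eqP x y : reflect (lpi x = lpi y) (x - y \in J).
Proof.
rewrite lpi.unlock -[_ \in J]/(_ \in as_zmod J) Quotient.idealrBE; exact: eqP.
Qed.

Lemma lpiB : {morph lpi : x y / x - y}.
Proof. by move=> x y; rewrite lpi.unlock !piE. Qed.

Lemma lpiD : {morph lpi : x y / x + y}.
Proof. by move=> x y; rewrite lpi.unlock !piE. Qed.

Definition lrepr (x : lquot) : V := repr (x : Quotient.quot (as_zmod J)).

Lemma lreprK : cancel lrepr lpi.
Proof. by move=> x; rewrite lpi.unlock; exact: reprK. Qed.

Lemma lrepr_pi x : lrepr (lpi x) - x \in J.
Proof. by apply/lpi_eqP; rewrite lreprK. Qed.

Definition lquot_scale (a : F) (x : lquot) : lquot := lpi (a *: lrepr x).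

Lemma lpiZ a x : lpi (a *: x) = lquot_scale a (lpi x).
Proof.
by apply/esym/lpi_eqP; rewrite -scalerBr rpredZ // lrepr_pi.
Qed.

Fact lquot_scaleA a b x :
  lquot_scale a (lquot_scale b x) = lquot_scale (a * b) x.
Proof. by rewrite -[x]lreprK -!lpiZ scalerA. Qed.
Fact lquot_scale1 : left_id 1 lquot_scale.
Proof. by move=> x; rewrite -[x]lreprK -!lpiZ scale1r. Qed.
Fact lquot_scaleDr : right_distributive lquot_scale +%R.
Proof.
by move=> a x y; rewrite -[x]lreprK -[y]lreprK -lpiD -!lpiZ scalerDr lpiD.
Qed.
Fact lquot_scaleDl x : {morph lquot_scale^~ x : a b / a + b}.
Proof. by move=> a b; rewrite -[x]lreprK -!lpiZ scalerDl lpiD. Qed.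

HB.instance Definition _ := GRing.Zmodule_isLmodule.Build F lquot
  lquot_scaleA lquot_scale1 lquot_scaleDr lquot_scaleDl.

Fact lpi_linear : linear lpi.
Proof. by move=> a x y; rewrite lpiD lpiZ. Qed.
HB.instance Definition _ := GRing.isLinear.Build F V lquot _ lpi lpi_linear.

End QuotientModuleTheory.

Section GeneratedSubalgebra.
Variables (F : fieldType) (A : algType F) (G : A -> Prop).

Definition gen_subalg : {pred A} := fun x =>
  `[< forall B : {pred A}, GRing.subalg_closed B ->
        (forall g, G g -> g \in B) -> x \in B >].

Lemma mem_gen_subalg x : G x -> x \in gen_subalg.
Proof. by move=> Gx; apply/asboolP => B _; exact. Qed.

Lemma gen_subalg_min (B : {pred A}) : GRing.subalg_closed B ->
  (forall g, G g -> g \in B) -> {subset gen_subalg <= B}.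
Proof. by move=> cB GB x /asboolP; exact. Qed.

Fact gen_subalg_closed : GRing.subalg_closed gen_subalg.
Proof.
split=> [|a x y /asboolP xG /asboolP yG|x y /asboolP xG /asboolP yG];
  apply/asboolP => B cB GB.
- by case: cB.
- by case: (cB) => _ lB _; apply: lB; [exact: xG|exact: yG].
- by case: (cB) => _ _ mB; apply: mB; [exact: xG|exact: yG].
Qed.
HB.instance Definition _ :=
  GRing.isSubalgClosed.Build F A gen_subalg gen_subalg_closed.

Record subalg : Type := Subalg { subalg_val :> A; _ : subalg_val \in gen_subalg }.
HB.instance Definition _ := [isSub for subalg_val].
HB.instance Definition _ := [Choice of subalg by <:].
HB.instance Definition _ := [SubChoice_isSubAlgebra of subalg by <:].

End GeneratedSubalgebra.

Section Modules.
Variables (F : fieldType) (A : algType F).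

Record left_module (M : lmodType F) (act : A -> M -> M) : Prop := {
  lmod_linl : forall u, linear (act^~ u);
  lmod_linr : forall x, linear (act x);
  lmod_one : forall u, act 1 u = u;
  lmod_mul : forall x y u, act (x * y) u = act x (act y u)
}.

Record right_module (M : lmodType F) (act : M -> A -> M) : Prop := {
  rmod_linl : forall x, linear (act^~ x);
  rmod_linr : forall u, linear (act u);
  rmod_one : forall u, act u 1 = u;
  rmod_mul : forall u x y, act u (x * y) = act (act u x) y
}.

Variable S : A -> Prop.

Definition left_ideal : {pred A} := fun x =>
  `[< exists2 s : seq (A * A), (forall p, p \in s -> S p.2) &
        x = \sum_(p <- s) p.1 * p.2 >].

Definition right_ideal : {pred A} := fun x =>
  `[< exists2 s : seq (A * A), (forall p, p \in s -> S p.2) &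
        x = \sum_(p <- s) p.2 * p.1 >].

Lemma left_idealMl a x : x \in left_ideal -> a * x \in left_ideal.
Proof.
move=> /asboolP[s sS ->]; apply/asboolP.
exists [seq (a * p.1, p.2) | p <- s]; first by move=> _ /mapP[p ps ->]; exact: (sS p).
by rewrite big_map mulr_sumr; apply: eq_bigr => p _; rewrite mulrA.
Qed.

Lemma right_idealMr a x : x \in right_ideal -> x * a \in right_ideal.
Proof.
move=> /asboolP[s sS ->]; apply/asboolP.
exists [seq (p.1 * a, p.2) | p <- s]; first by move=> _ /mapP[p ps ->]; exact: (sS p).
by rewrite big_map mulr_suml; apply: eq_bigr => p _; rewrite mulrA.
Qed.

Fact left_ideal_submod : GRing.submod_closed left_ideal.
Proof.
split=> [|a x y xJ yJ].
  by apply/asboolP; exists [::] => //; rewrite big_nil.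
have : a%:A * x \in left_ideal by exact: left_idealMl.
rewrite -scalerAl mul1r => /asboolP[s sS ->]; move: yJ => /asboolP[t tS ->].
apply/asboolP; exists (s ++ t); last by rewrite big_cat.
by move=> p; rewrite mem_cat => /orP[/sS|/tS].
Qed.
HB.instance Definition _ :=
  GRing.isSubmodClosed.Build F A left_ideal left_ideal_submod.

Fact right_ideal_submod : GRing.submod_closed right_ideal.
Proof.
split=> [|a x y xJ yJ].
  by apply/asboolP; exists [::] => //; rewrite big_nil.
have : x * a%:A \in right_ideal by exact: right_idealMr.
rewrite -scalerAr mulr1 => /asboolP[s sS ->]; move: yJ => /asboolP[t tS ->].
apply/asboolP; exists (s ++ t); last by rewrite big_cat.
by move=> p; rewrite mem_cat => /orP[/sS|/tS].
Qed.
HB.instance Definition _ :=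
  GRing.isSubmodClosed.Build F A right_ideal right_ideal_submod.

Definition left_cyclic : lmodType F := lquot left_ideal.
Definition lact (x : A) (v : left_cyclic) : left_cyclic :=
  lpi left_ideal (x * lrepr v).
Definition lcyc_gen : left_cyclic := lpi left_ideal 1.

Definition right_cyclic : lmodType F := lquot right_ideal.
Definition ract (v : right_cyclic) (x : A) : right_cyclic :=
  lpi right_ideal (lrepr v * x).
Definition rcyc_gen : right_cyclic := lpi right_ideal 1.

Lemma lact_pi x y : lact x (lpi left_ideal y) = lpi left_ideal (x * y).
Proof. by apply/lpi_eqP; rewrite -mulrBr left_idealMl // lrepr_pi. Qed.

Lemma ract_pi x y : ract (lpi right_ideal y) x = lpi right_ideal (y * x).
Proof. by apply/lpi_eqP; rewrite -mulrBl right_idealMr // lrepr_pi. Qed.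

Lemma lact_module : left_module lact.
Proof.
split=> [v a x y|x a v w|v|x y v].
- by rewrite /lact mulrDl -scalerAl linearP.
- rewrite -[v]lreprK -[w]lreprK -linearP !lact_pi.
  by rewrite mulrDr -scalerAr linearP.
- by rewrite /lact mul1r lreprK.
- by rewrite -[v]lreprK !lact_pi mulrA.
Qed.

Lemma ract_module : right_module ract.
Proof.
split=> [x a v w|v a x y|v|v x y].
- rewrite -[v]lreprK -[w]lreprK -linearP !ract_pi.
  by rewrite mulrDl -scalerAl linearP.
- by rewrite /ract mulrDr -scalerAr linearP.
- by rewrite /ract mulr1 lreprK.
- by rewrite -[v]lreprK !ract_pi mulrA.
Qed.

End Modules.

Lemma malg_scaleAr (K : monomType) (R : comNzRingType) (c : R)
  (x y : {malg R[K]}) : c *: (x * y) = x * (c *: y).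
Proof.
have cC : c *: x = x * c%:MP.
  rewrite malgM_def fgmulgU -mul_malgC malgM_def fgmulUg.
  by apply: eq_bigr => k _; rewrite mulm1 mul1m mulrC.
by rewrite -[in RHS]mul_malgC mulrA -cC scalerAl.
Qed.

HB.lock Definition frvar (F : fieldType) (X : choiceType) (g : X) :
  {malg F[{fmonom X}]} := << fmu g >>.


(* The base field and the parameter stay abstract here; they are specialized
   to [Qq = Q(q)] and [qvar = q] at the end of the file. *)
Section QuantumGroup.
Variables (F : fieldType) (q : F).
Variables (I : choiceType) (P : zmodType) (D : cartan_datum I P).
Notation a := (cartan D).
Notation alpha := (alpha D).
Notation h := (coroot D).

(* (alpha_i, alpha_i) / 2, a positive integer by [form_alpha] *)
Definition half_norm (i : I) : nat :=
  `|numq (bilform D (alpha i) (alpha i) / 2)|%N.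

Definition qi (i : I) : F := q ^+ half_norm i.

Definition qint (i : I) (n : nat) : F :=
  (qi i ^+ n - qi i ^- n) / (qi i - (qi i)^-1).

Definition qfact (i : I) (n : nat) : F := \prod_(1 <= k < n.+1) qint i k.

(* the simple reflection s_i on the dual lattice *)
Definition refl (i : I) (k : dual P) : dual P := k - h i *~ k (alpha i).

Definition divpow (A : lalgType F) (i : I) (z : A) (s : nat) : A :=
  (qfact i s)^-1 *: z ^+ s.

Definition qgen : choiceType := (I + I + dual P)%type.
Definition fralg : lalgType F := {malg F[{fmonom qgen}]}.

Definition fe (i : I) : fralg := frvar F (inl (inl i) : qgen).
Definition ff (i : I) : fralg := frvar F (inl (inr i) : qgen).
Definition fK (k : dual P) : fralg := frvar F (inr k : qgen).
(* t_i and its inverse, as q^{(alpha_i, alpha_i)/2 h_i} *)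
Definition ft (i : I) : fralg := fK (h i *+ half_norm i).
Definition ftV (i : I) : fralg := fK (- (h i *+ half_norm i)).

Definition fserre (z : I -> fralg) (i j : I) : fralg :=
  let n := `|1 - a i j|%N in
  \sum_(s < n.+1) (-1) ^+ s *: (divpow i (z i) s * z j * divpow i (z i) (n - s)).

(* Each [relator x] stands for the defining relation [x = 0]. *)
Inductive relator : fralg -> Prop :=
| rel_K0 : relator (fK 0 - 1)
| rel_KD k l : relator (fK k * fK l - fK (k + l))
| rel_Ke k i : relator (fK k * fe i * fK (- k) - q ^ (k (alpha i)) *: fe i)
| rel_Kf k i : relator (fK k * ff i * fK (- k) - q ^ (- k (alpha i)) *: ff i)
| rel_ef i j : relator (fe i * ff j - ff j * fe i -
    (if i == j then (qi i - (qi i)^-1)^-1 *: (ft i - ftV i) else 0))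
| rel_serre_e i j : i != j -> relator (fserre fe i j)
| rel_serre_f i j : i != j -> relator (fserre ff i j).

Inductive two_sided : fralg -> Prop :=
| ts_rel x : relator x -> two_sided x
| ts_0 : two_sided 0
| ts_D x y : two_sided x -> two_sided y -> two_sided (x + y)
| ts_M x y z : two_sided x -> two_sided (y * x * z).

Definition rel_ideal : {pred fralg} := fun x => `[< two_sided x >].

Lemma rel_idealM x y z : x \in rel_ideal -> y * x * z \in rel_ideal.
Proof. by move=> /asboolP xJ; apply/asboolP; exact: ts_M. Qed.

Fact rel_ideal_submod : GRing.submod_closed rel_ideal.
Proof.
split=> [|c x y /asboolP xJ /asboolP yJ]; apply/asboolP; first exact: ts_0.
apply: ts_D => //; rewrite -[x]mul1r scalerAl -[_ * x]mulr1; exact: ts_M.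
Qed.
HB.instance Definition _ :=
  GRing.isSubmodClosed.Build F fralg rel_ideal rel_ideal_submod.

Definition Uq : Type := lquot rel_ideal.
HB.instance Definition _ := GRing.Lmodule.on Uq.

Definition upi (x : fralg) : Uq := lpi rel_ideal x.
Definition Uq_one : Uq := upi 1.

End QuantumGroup.

HB.lock Definition Uq_mul (F : fieldType) (q : F) (I : choiceType)
  (P : zmodType) (D : cartan_datum I P) (x y : Uq q D) : Uq q D :=
  upi q D (lrepr x * lrepr y).

Section QuantumAlgebra.
Variables (F : fieldType) (q : F).
Variables (I : choiceType) (P : zmodType) (D : cartan_datum I P).
Notation a := (cartan D).
Notation alpha := (alpha D).
Notation h := (coroot D).
Notation qgen := (qgen I P).
Notation fralg := (fralg F I P).
Notation rel_ideal := (rel_ideal q D).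
Notation two_sided := (two_sided q D).
Notation relator := (relator q D).
Notation Uq := (Uq q D).
Notation upi := (upi q D).
Notation Uq_one := (Uq_one q D).
Notation Uq_mul := (@Uq_mul F q I P D).
Notation fe := (@fe F I P).
Notation ff := (@ff F I P).
Notation fK := (@fK F I P).
Notation qi := (qi q D).
Notation half_norm := (half_norm D).
Notation divpow := (divpow q D).
Notation refl := (refl D).
Notation fserre := (fserre q D).

Lemma upiM x y : upi (x * y) = Uq_mul (upi x) (upi y).
Proof.
rewrite Uq_mul.unlock; apply/esym/lpi_eqP; set x' := lrepr _; set y' := lrepr _.
have -> : x' * y' - x * y = 1 * (x' - x) * y' + x * (y' - y) * 1.
  by rewrite mul1r mulr1 mulrBl mulrBr addrA subrK.
by apply: rpredD; apply: rel_idealM; exact: lrepr_pi.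
Qed.

Lemma upi_surj (x : Uq) : x = upi (lrepr x).
Proof. exact/esym/lreprK. Qed.

Fact Uq_mulA : associative Uq_mul.
Proof.
by move=> x y z; rewrite (upi_surj x) (upi_surj y) (upi_surj z) -!upiM mulrA.
Qed.
Fact Uq_mul1 : left_id Uq_one Uq_mul.
Proof. by move=> x; rewrite (upi_surj x) -upiM mul1r. Qed.
Fact Uq_1mul : right_id Uq_one Uq_mul.
Proof. by move=> x; rewrite (upi_surj x) -upiM mulr1. Qed.
Fact Uq_mulDl : left_distributive Uq_mul +%R.
Proof.
move=> x y z; rewrite (upi_surj x) (upi_surj y) (upi_surj z).
by rewrite /upi -linearD -!/(upi _) -!upiM mulrDl /upi linearD.
Qed.
Fact Uq_mulDr : right_distributive Uq_mul +%R.
Proof.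
move=> x y z; rewrite (upi_surj x) (upi_surj y) (upi_surj z).
by rewrite /upi -linearD -!/(upi _) -!upiM mulrDr /upi linearD.
Qed.

(* The counit, used only to see that [Uq] is not the zero ring. *)
Definition counit_mon (m : {fmonom qgen}) : F :=
  \prod_(g <- (m : seq qgen)) (if g is inr _ then 1 else 0).
Fact counit_mon_mult : monalg.mmorphism counit_mon.
Proof.
split=> [m n|]; last by rewrite /counit_mon fm1 big_nil.
by rewrite /counit_mon fmM big_cat.
Qed.
HB.instance Definition _ :=
  monalg.isMultiplicative.Build {fmonom qgen} F counit_mon counit_mon_mult.

Definition counit : fralg -> F := mmap idfun counit_mon.
HB.instance Definition _ := GRing.LRMorphism.on counit.

Fact counit_var (g : qgen) : counit (frvar F g) = if g is inr _ then 1 else 0.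
Proof. by rewrite /counit frvar.unlock mmapU mul1r /counit_mon fmU big_seq1. Qed.

Fact counitD x y : counit (x + y) = counit x + counit y.
Proof. exact: raddfD. Qed.
Fact counit0 : counit 0 = 0.
Proof. exact: raddf0. Qed.
Fact counitB x y : counit (x - y) = counit x - counit y.
Proof. exact: raddfB. Qed.
Fact counitM x y : counit (x * y) = counit x * counit y.
Proof. exact: rmorphM. Qed.
Fact counitZ c x : counit (c *: x) = c * counit x.
Proof. exact: linearZ. Qed.

Fact counit_e i : counit (fe i) = 0. Proof. exact: counit_var. Qed.
Fact counit_f i : counit (ff i) = 0. Proof. exact: counit_var. Qed.
Fact counit_K k : counit (fK k) = 1. Proof. exact: counit_var. Qed.
Fact counit1 : counit 1 = 1. Proof. exact: rmorph1. Qed.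

Fact counit_serre (z : I -> fralg) i j :
  counit (z j) = 0 -> counit (fserre z i j) = 0.
Proof.
move=> z0; rewrite /fserre (big_morph _ counitD counit0) big1 // => s _.
by rewrite counitZ !counitM z0 mulr0 mul0r mulr0.
Qed.

Fact counit_relator x : relator x -> counit x = 0.
Proof.
case=> [|k l|k i|k i|i j|i j _|i j _].
- by rewrite counitB counit_K counit1 subrr.
- by rewrite counitB counitM !counit_K mulr1 subrr.
- by rewrite counitB counitZ !counitM counit_e !mulr0 mul0r subrr.
- by rewrite counitB counitZ !counitM counit_f !mulr0 mul0r subrr.
- have ef0 : counit (fe i * ff j - ff j * fe i) = 0.
    have l0 : counit (fe i * ff j) = 0 by rewrite counitM counit_e mul0r.
    have r0 : counit (ff j * fe i) = 0 by rewrite counitM counit_e mulr0.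
    apply/eqP; rewrite counitB subr_eq0; apply/eqP.
    exact: etrans l0 (esym r0).
  rewrite counitB ef0 sub0r.
  case: ifP => _; last by rewrite counit0 oppr0.
  by rewrite counitZ counitB !counit_K subrr mulr0 oppr0.
- by apply: counit_serre; exact: counit_e.
- by apply: counit_serre; exact: counit_f.
Qed.

Fact counit_ideal x : two_sided x -> counit x = 0.
Proof.
elim=> [{}x||y z _ y0 _ z0|y u v _ y0].
- exact: counit_relator.
- exact: counit0.
- by rewrite counitD y0 z0 addr0.
- by rewrite !counitM y0 mulr0 mul0r.
Qed.

Fact Uq_oner_neq0 : Uq_one != 0.
Proof.
apply/eqP => U0; have /lpi_eqP : lpi rel_ideal 1 = lpi rel_ideal 0.
  by rewrite [RHS]linear0; exact: U0.
by rewrite subr0 => /asboolP/counit_ideal/eqP; rewrite rmorph1 oner_eq0.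
Qed.

HB.instance Definition _ := GRing.Zmodule_isNzRing.Build Uq
  Uq_mulA Uq_mul1 Uq_1mul Uq_mulDl Uq_mulDr Uq_oner_neq0.

Fact Uq_scaleAl (c : F) (x y : Uq) : c *: (x * y) = (c *: x) * y.
Proof.
have upiZ z : upi (c *: z) = c *: upi z by rewrite /upi linearZ.
rewrite (upi_surj x) (upi_surj y) -[_ * _ in LHS]upiM -!upiZ.
by rewrite -[RHS]upiM scalerAl.
Qed.
HB.instance Definition _ := GRing.Lmodule_isLalgebra.Build F Uq Uq_scaleAl.

Fact Uq_scaleAr (c : F) (x y : Uq) : c *: (x * y) = x * (c *: y).
Proof.
have upiZ z : upi (c *: z) = c *: upi z by rewrite /upi linearZ.
rewrite (upi_surj x) (upi_surj y) -[_ * _ in LHS]upiM -!upiZ.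
by rewrite -[RHS]upiM malg_scaleAr.
Qed.
HB.instance Definition _ := GRing.Lalgebra_isAlgebra.Build F Uq Uq_scaleAr.

Definition Ue (i : I) : Uq := upi (fe i).
Definition Uf (i : I) : Uq := upi (ff i).
Definition UK (k : dual P) : Uq := upi (fK k).
Definition Ut (i : I) : Uq := UK (h i *+ half_norm i).
Definition UtV (i : I) : Uq := UK (- (h i *+ half_norm i)).

Definition Uminus : {pred Uq} := gen_subalg (fun x => exists j, x = Uf j).

Section FixedIndex.
Variable i : I.

Definition ad_f (u : Uq) : Uq := Uf i * u - Ut i * u * UtV i * Uf i.
Definition ad_e (u : Uq) : Uq := Ue i * u * Ut i - u * Ue i * Ut i.
Definition ads_f (u : Uq) : Uq := u * Uf i - Uf i * Ut i * u * UtV i.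
Definition ads_e (u : Uq) : Uq := UtV i * u * Ue i - UtV i * Ue i * u.

(* [T] is meant to be an algebra morphism, so that bijectivity makes it an
   automorphism and the values on generators determine it. *)
Record is_braid (T : Uq -> Uq) : Prop := {
  braid_bij : bijective T;
  braid_K : forall k, T (UK k) = UK (refl i k);
  braid_ei : T (Ue i) = - (UtV i * Uf i);
  braid_fi : T (Uf i) = - (Ue i * Ut i);
  braid_e : forall j, j != i -> T (Ue j) =
    let n := `|- a i j|%N in
    \sum_(r < n.+1) ((-1) ^+ r * qi i ^- r) *:
      (divpow i (Ue i) r * Ue j * divpow i (Ue i) (n - r));
  braid_f : forall j, j != i -> T (Uf j) =
    let n := `|- a i j|%N in
    \sum_(r < n.+1) ((-1) ^+ r * qi i ^+ r) *:
      (divpow i (Uf i) (n - r) * Uf j * divpow i (Uf i) r)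
}.

(* generators of U_q(p_i): e_i, all f_j, all q^k *)
Definition p_gen (x : Uq) : Prop :=
  [\/ x = Ue i, exists j, x = Uf j | exists k, x = UK k].

Definition Up : algType F := subalg p_gen.

Definition pe : Up := Subalg (mem_gen_subalg (Or31 _ _ (erefl (Ue i)))).
Definition pf (j : I) : Up :=
  Subalg (mem_gen_subalg (Or32 _ _ (ex_intro _ j (erefl (Uf j))))).
Definition pK (k : dual P) : Up :=
  Subalg (mem_gen_subalg (Or33 _ _ (ex_intro _ k (erefl (UK k))))).

(* The one-sided ideals of U_q(p_i) generated by these elements are the ones
   defining V_i(0) and iV(0). *)
Definition p_ann (x : Up) : Prop :=
  [\/ x = pe, x = pf i | exists k, x = pK k - 1].

Definition Vi0 : lmodType F := left_cyclic p_ann.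
Definition iV0 : lmodType F := right_cyclic p_ann.

Lemma Uminus_sub_Up u : u \in Uminus -> u \in gen_subalg p_gen.
Proof.
apply: gen_subalg_min; first exact: gen_subalg_closed.
by move=> _ [j ->]; exact: valP (pf j).
Qed.

Section Braid.
Variable T : {lrmorphism Uq -> Uq}.

Definition Ui_set : {pred Uq} := fun u =>
  (u \in Uminus) && `[< exists2 w, w \in Uminus & u = T w >].

(* [T] being bijective, [T^-1 Uminus] is the preimage of [Uminus]. *)
Definition iU_set : {pred Uq} := fun u => (u \in Uminus) && (T u \in Uminus).

Fact Ui_submod : GRing.submod_closed Ui_set.
Proof.
split=> [|c x y /andP[xm /asboolP[v vm xE]] /andP[ym /asboolP[w wm yE]]].
  apply/andP; split; first exact: rpred0.
  by apply/asboolP; exists 0; rewrite ?rpred0 ?linear0.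
apply/andP; split; first by rewrite rpredD ?rpredZ.
apply/asboolP; exists (c *: v + w); first by rewrite rpredD ?rpredZ.
by rewrite linearP xE yE.
Qed.
HB.instance Definition _ := GRing.isSubmodClosed.Build F Uq Ui_set Ui_submod.

Fact iU_submod : GRing.submod_closed iU_set.
Proof.
split=> [|c x y /andP[xm Tx] /andP[ym Ty]].
  by apply/andP; rewrite linear0 !rpred0.
by apply/andP; rewrite linearP !rpredD ?rpredZ.
Qed.
HB.instance Definition _ := GRing.isSubmodClosed.Build F Uq iU_set iU_submod.

Record Ui : Type := MkUi { Ui_val :> Uq; _ : Ui_val \in Ui_set }.
HB.instance Definition _ := [isSub for Ui_val].
HB.instance Definition _ := [Choice of Ui by <:].
HB.instance Definition _ := [SubChoice_isSubLmodule of Ui by <:].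

Record iU : Type := MkiU { iU_val :> Uq; _ : iU_val \in iU_set }.
HB.instance Definition _ := [isSub for iU_val].
HB.instance Definition _ := [Choice of iU by <:].
HB.instance Definition _ := [SubChoice_isSubLmodule of iU by <:].

Fact Ui_in_Up (u : Ui) : Ui_val u \in gen_subalg p_gen.
Proof. by case: u => u /= /andP[um _]; exact: Uminus_sub_Up. Qed.
Fact iU_in_Up (u : iU) : iU_val u \in gen_subalg p_gen.
Proof. by case: u => u /= /andP[um _]; exact: Uminus_sub_Up. Qed.

Definition Ui_to_Vi0 (u : Ui) : Vi0 := lact (Subalg (Ui_in_Up u)) (lcyc_gen p_ann).
Definition iU_to_iV0 (u : iU) : iV0 := ract (rcyc_gen p_ann) (Subalg (iU_in_Up u)).

End Braid.
End FixedIndex.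
End QuantumAlgebra.

Definition Qq : fieldType := {fraction {poly rat}}.
Definition qvar : Qq := tofrac 'X.

(* Main.v *)
(** Every element of [U_i] is determined by its image in [V_i(0)], and both sides
    are generated by the strings [ad_{f_i}^m (f_j)], [j <> i].

    Surjectivity: let [B] be the subalgebra generated by the [ad_{f_i}^m (f_j)]
    with [m <= - a_ij].  By the Serre relations and sl_2-theory [B] is stable
    under [ad_{f_i}], [ad_{e_i}], left multiplication by [f_j] and conjugation by
    [q^h], and modulo the defining left ideal of [V_i(0)] the generators of
    [U_q(p_i)] act on [B] by these operators, so [B] maps onto [V_i(0)].
    Moreover [T_i] sends [ad^*_{f_i}^k (f_j)] to a nonzero multiple of
    [ad_{f_i}^{-a_ij-k} (f_j)], so [B] is contained in [U_i].

    Injectivity: the Verma module of highest weight 0 is free over [U_q^-].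
    Hence [u] in [U_i] with [u v_0 = 0] has the form [y f_i] with [y] in [U_q^-];
    then [T_i^{-1} u] lies in [U_q^-] and in [U_q(g) e_i], and it kills the
    highest weight vector of the Verma module, so it is 0.  Therefore [U_i = B].

    The right-handed part follows by the antiautomorphism [S] fixing [e_j], [f_j]
    and inverting [q^h]: it exchanges the two adjoint actions, and [S T_i S]
    inverts [T_i] on [U_q^-]. *)
Require Import Defs.
From HB Require Import structures.
From mathcomp Require Import all_boot all_order all_algebra.
From mathcomp Require Import boolp ring finmap.
From mathcomp.multinomials Require Import monalg.
Import GRing.Theory Num.Theory.
Local Open Scope ring_scope.

Set Implicit Arguments.
Unset Strict Implicit.
Unset Printing Implicit Defensive.

(** * Quantum integers and iterated q-commutators *)

(** The module axioms are never checked on generators and relations: the action on [U_i] is the one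
    of [V_i(0)], pulled back along the bijection. Linearity of the isomorphism is then automatic,
    and what remains is to see that each generator acts by the prescribed operator, i.e. that this
    operator preserves [U_i] and agrees with left multiplication modulo the defining ideal.

    Freeness of the Verma module is obtained without a PBW basis. The free algebra on the [f_j]
    carries operators [e_i], [f_i], [q^h] satisfying all relations except the Serre relations in the
    [f_j]. Serre elements in the [f_j] commute with every [e_l] already without Serre relations, so
    the ideal they generate is stable under all operators, and dividing by it gives exactly [U_q^-].

    Serre elements, the strings and [T_i(f_j)] are all values of one iterated q-commutator, whose
    closed form is a q-binomial sum. Its commutator with [e_i] has the sl_2 coefficient
    [[m][N - m + 1]], where [N = - a_ij]; the zero at [m = N + 1] is the reason why the Serre
    element commutes with [e_i]. *)

HB.lock Definition qnum (F : fieldType) (p : F) (n : nat) : F :=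
  (p ^+ n - p ^- n) / (p - p^-1).

Section QuantumIntegers.
Variables (F : fieldType) (p : F).
Notation qnum := (qnum p).

Lemma qnum0 : qnum 0 = 0.
Proof. by rewrite qnum.unlock expr0 invr1 subrr mul0r. Qed.

Definition qnum_fact (n : nat) : F := \prod_(1 <= k < n.+1) qnum k.

Hypothesis p0 : p != 0.
Hypothesis p1 : forall n, (0 < n)%N -> p ^+ n != 1.

Lemma subV_neq0 : p - p^-1 != 0.
Proof.
have := @p1 2 isT; apply: contra; rewrite subr_eq0 => /eqP pE.
by rewrite expr2 {1}pE mulVf.
Qed.

Lemma qnum_neq0 n : (0 < n)%N -> qnum n != 0.
Proof.
move=> n0; rewrite qnum.unlock mulf_neq0 ?invr_neq0 ?subV_neq0 //.
have := @p1 (n + n)%N; rewrite addn_gt0 n0 => /(_ isT); apply: contra.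
by rewrite subr_eq0 => /eqP pE; rewrite exprD {1}pE mulVf // expf_neq0.
Qed.

Lemma qnum_fact0 : qnum_fact 0 = 1.
Proof. by rewrite /qnum_fact big_nil. Qed.

Lemma qnum_factS n : qnum_fact n.+1 = qnum n.+1 * qnum_fact n.
Proof. by rewrite /qnum_fact big_nat_recr //= mulrC. Qed.

Lemma qnum_fact_neq0 n : qnum_fact n != 0.
Proof.
elim: n => [|n IH]; first by rewrite qnum_fact0 oner_neq0.
by rewrite qnum_factS mulf_neq0 // qnum_neq0.
Qed.

(** The q-Pascal rule in symmetric form; with [s + r = m + 1] it is the comparison of coefficients
    in [qsum_rec]. *)
Lemma qnumD s r : qnum (s + r) = p ^+ s * qnum r + p ^- r * qnum s.
Proof.
rewrite qnum.unlock !exprD.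
have a0 : p ^+ s != 0 by exact: expf_neq0.
have b0 : p ^+ r != 0 by exact: expf_neq0.
rewrite !mulrA -mulrDl; congr (_ / _).
move: (p ^+ s) (p ^+ r) a0 b0 => a b a0 b0.
by field; rewrite a0 b0.
Qed.
End QuantumIntegers.

HB.lock Definition qpow (F : fieldType) (p : F) (A : lalgType F) (z : A)
  (s : nat) : A := (qnum_fact p s)^-1 *: z ^+ s.

Section Expansion.
Variables (F : fieldType) (p : F).
Hypothesis p0 : p != 0.
Hypothesis p1 : forall n, (0 < n)%N -> p ^+ n != 1.
Notation qn := (qnum p).
Notation qf := (qnum_fact p).

Notation qpow := (qpow p).

Lemma qpow0 (A : lalgType F) (z : A) : qpow z 0 = 1.
Proof. by rewrite qpow.unlock qnum_fact0 invr1 scale1r. Qed.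

Lemma qpowSl (A : algType F) (z : A) s : z * qpow z s = qn s.+1 *: qpow z s.+1.
Proof.
rewrite qpow.unlock scalerA qnum_factS invfM mulrA mulfV ?qnum_neq0 // mul1r.
by rewrite -scalerAr exprS.
Qed.

Lemma qpowSr (A : algType F) (z : A) s : qpow z s * z = qn s.+1 *: qpow z s.+1.
Proof.
rewrite qpow.unlock scalerA qnum_factS invfM mulrA mulfV ?qnum_neq0 // mul1r.
by rewrite -scalerAl exprSr.
Qed.

Variables (A : algType F) (f x : A).

(** For [c = 1] this is, up to sign and order of summation, the Serre sum; for [c = p] and
    [m = - a_ij] it is the braid formula for [T_i (f_j)]. Keeping [c] free lets one expansion serve
    both. *)
Definition qsum (c : F) (m : nat) : A :=
  \sum_(s < m.+1) ((-1) ^+ s * c ^+ s) *: (qpow f (m - s) * x * qpow f s).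

(** The parameter is [w p^(1-m)], so it loses one factor [p] from [m] to [m + 1]; this is the shift
    under which the two products on the left merge by the q-Pascal rule. *)
Lemma qsum_rec w m :
  f * qsum (w * p / p ^+ m) m - (w / p ^+ (m + m)) *: (qsum (w * p / p ^+ m) m * f)
  = qn m.+1 *: qsum (w * p / p ^+ m.+1) m.+1.
Proof.
set c := w * p / p ^+ m; set d := w * p / p ^+ m.+1.
have cE : c = d * p.
  by rewrite /c /d exprS; field; rewrite p0 expf_neq0.
rewrite /qsum mulr_sumr mulr_suml.
pose t (s : nat) := qpow f (m.+1 - s) * x * qpow f s.
have fE (s : 'I_m.+1) : f * (((-1) ^+ s * c ^+ s) *: (qpow f (m - s) * x * qpow f s))
   = ((-1) ^+ s * c ^+ s * qn (m.+1 - s)) *: t s.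
  by rewrite -scalerAr !mulrA (qpowSl f (m - s)) /t subSn ?leq_ord // -!scalerAl scalerA.
have Ef (s : 'I_m.+1) : (((-1) ^+ s * c ^+ s) *: (qpow f (m - s) * x * qpow f s)) * f
   = ((-1) ^+ s * c ^+ s * qn s.+1) *: t s.+1.
  by rewrite -scalerAl -!mulrA (qpowSr f s) /t subSS -!scalerAr scalerA !mulrA.
rewrite (eq_bigr _ (fun s _ => fE s)) (eq_bigr _ (fun s _ => Ef s)).
(* Both sums are extended to the range [s <= m + 1]: the new term (last in the first sum, first in
   the second) carries [[0] = 0], so the value of [s.-1] at [s = 0] is harmless. *)
have -> : \sum_(s < m.+1) ((-1) ^+ s * c ^+ s * qn (m.+1 - s)) *: t s =
          \sum_(s < m.+2) ((-1) ^+ s * c ^+ s * qn (m.+1 - s)) *: t s.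
  by rewrite [RHS]big_ord_recr /= subnn qnum0 mulr0 scale0r addr0.
have -> : \sum_(s < m.+1) ((-1) ^+ s * c ^+ s * qn s.+1) *: t s.+1 =
          \sum_(s < m.+2) ((-1) ^+ s.-1 * c ^+ s.-1 * qn s) *: t s.
  by rewrite [RHS]big_ord_recl /= qnum0 mulr0 scale0r add0r.
rewrite scaler_sumr -sumrB scaler_sumr; apply: eq_bigr => s _.
rewrite !scalerA -scalerBl; congr (_ *: _).
case: s => [[|s] /= sm].
  by rewrite !expr0 subn0 qnum0 !(mul0r, mulr0) subr0 !mul1r mulr1.
rewrite ltnS in sm; have -> : (m.+1 = s.+1 + (m.+1 - s.+1))%N by rewrite subnKC.
rewrite [in RHS]qnumD // addKn.
have : d = w * p / p ^+ (s.+1 + (m.+1 - s.+1)) by rewrite subnKC.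
have : (m = s + (m.+1 - s.+1))%N by rewrite subSS subnKC.
rewrite cE; move: (m.+1 - s.+1)%N => r -> dE.
rewrite !(exprS _ s) !(exprMn s d p).
have a0 : p ^+ s != 0 by exact: expf_neq0.
have b0 : p ^+ r != 0 by exact: expf_neq0.
move: (d ^+ s) => e; rewrite dE !exprD !exprS.
move: (p ^+ s) (p ^+ r) (qn s.+1) (qn r) ((-1) ^+ s) a0 b0 => a b u v z a0 b0.
by field; rewrite a0 b0.
Qed.
End Expansion.

Section AdjointString.
Variables (F : fieldType) (p : F).
Hypothesis p0 : p != 0.
Hypothesis p1 : forall n, (0 < n)%N -> p ^+ n != 1.
Notation qn := (qnum p).
Notation qf := (qnum_fact p).
Variables (A : algType F).

(* [t x t^-1 = w x] turns [ad_f] into the q-commutator below. *)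
Fixpoint adstring (f x : A) (w : F) (m : nat) : A :=
  if m is n.+1 then
    f * adstring f x w n - (w / p ^+ (n + n)) *: (adstring f x w n * f)
  else x.

Lemma adstringE f x w m :
  adstring f x w m = qf m *: qsum p f x (w * p / p ^+ m) m.
Proof.
elim: m => [|m IH] /=.
  rewrite qnum_fact0 scale1r /qsum big_ord_recl big_ord0 /= !expr0 mulr1 scale1r.
  by rewrite subn0 !qpow0 mul1r mulr1 addr0.
rewrite IH -scalerAr -scalerAl !scalerA [_ / _ * _]mulrC -scalerA -scalerBr.
by rewrite qsum_rec // scalerA qnum_factS mulrC.
Qed.

Variables (e f t t' x : A) (w : F).
Hypothesis tt' : t * t' = 1.
Hypothesis t't : t' * t = 1.
Hypothesis tf : t * f = p ^- 2 *: (f * t).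
Hypothesis ef : e * f - f * e = (p - p^-1)^-1 *: (t - t').
Hypothesis w0 : w != 0.
Hypothesis tx : t * x = w *: (x * t).
Hypothesis ex : e * x = x * e.
Notation X := (adstring f x w).

Lemma adstring_wt m : t * X m = (w / p ^+ (m + m)) *: (X m * t).
Proof.
elim: m => [|m IH] /=; first by rewrite expr0 divr1.
set k := w / p ^+ (m + m) in IH *.
have kE : w / p ^+ (m.+1 + m.+1) = k / p ^+ 2.
  rewrite /k addSn addnS -addn2 exprD; field.
  by rewrite p0 expf_neq0.
have tfX : t * (f * X m) = (k / p ^+ 2) *: (f * X m * t).
  by rewrite mulrA tf -scalerAl -[f * t * _]mulrA IH -scalerAr scalerA [f * (_ * t)]mulrA mulrC.
have tXf : t * (X m * f) = (k / p ^+ 2) *: (X m * f * t).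
  by rewrite mulrA IH -scalerAl -[_ * t * f]mulrA tf -scalerAr scalerA mulrA.
rewrite kE mulrBr mulrBl -scalerAr tfX tXf scalerBr -scalerAl.
by rewrite !scalerA [k * (k / _)]mulrC.
Qed.

Lemma adstring_wtV m : t' * X m = (w / p ^+ (m + m))^-1 *: (X m * t').
Proof.
set k := w / _.
have k0 : k != 0 by rewrite mulf_neq0 ?invr_neq0 ?expf_neq0.
apply: (canRL (scalerK k0)); rewrite -[t' * _]mulr1 -tt' mulrA -[t' * X m * t]mulrA.
by rewrite scalerAl scalerAr -adstring_wt mulrA t't mul1r.
Qed.

Lemma commutator_step (X Y a : A) k : e * f = f * e + a -> e * X = X * e + Y ->
  e * (f * X - k *: (X * f)) - (f * X - k *: (X * f)) * e
  = a * X + f * Y - k *: (Y * f + X * a).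
Proof.
move=> fE XE.
have fXE : e * (f * X) = f * X * e + (f * Y + a * X).
  by rewrite mulrA fE mulrDl -[f * e * X]mulrA XE mulrDr !mulrA addrA.
have XfE : e * (X * f) = X * f * e + (Y * f + X * a).
  by rewrite mulrA XE mulrDl -[X * e * f]mulrA fE mulrDr !mulrA -addrA [X * a + _]addrC.
rewrite mulrBr mulrBl -scalerAr -scalerAl fXE XfE scalerDr opprD opprB.
rewrite addrC [X in _ + X]addrACA -[f * X * e - _]opprB addNKr.
by rewrite [f * Y + _]addrC.
Qed.

(** For [w = p^n] this is [[m][n - m + 1]], the coefficient of [e f^m v] on a highest weight vector
    of weight [n]; it vanishes at [m = n + 1]. *)
Definition adcoef m := qn m * ((w * p / p ^+ m - (w * p / p ^+ m)^-1) / (p - p^-1)).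

Lemma adcoefS m :
  adcoef m.+1 = adcoef m + (p - p^-1)^-1 * (w / p ^+ (m + m) - (w / p ^+ (m + m))^-1).
Proof.
rewrite /adcoef qnum.unlock !exprD !exprS.
have d0 := subV_neq0 p0 p1.
have a0 : p ^+ m != 0 by exact: expf_neq0.
(* The term linear in [d] is multiplied by [d (p - p^-1) = 1]. Every term is then quadratic in [d],
   and the identity holds for an arbitrary [d]. *)
set d := (p - p^-1)^-1; have dE : d * (p - p^-1) = 1 by rewrite mulVf.
rewrite -[in RHS](mulr1 (_ * (_ - _))) -dE; move: d dE => d dE.
move: (p ^+ m) a0 => a a0.
by field; rewrite a0 w0 p0.
Qed.

(** Two contributions add up: the bracket of [e] with the outer [f] gives [t - t'], which acts on
    [X m] by its weight; the bracket with the inner string gives a multiple of [X m.-1 * t'], which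
    the q-commutator with [f] turns into a multiple of [X m * t']. The assertion [step] isolates one
    such step, with [Y = 0] at the bottom. *)
Lemma adstring_e m : e * X m.+1 - X m.+1 * e = adcoef m.+1 *: (X m * t').
Proof.
set c := (p - p^-1)^-1.
have efE : e * f = f * e + c *: (t - t') by rewrite -ef addrC subrK.
have p2 : p ^- 2 != 0 by rewrite invr_neq0 ?expf_neq0.
have t'f : t' * f = p ^+ 2 *: (f * t').
  rewrite -[p ^+ 2]invrK; apply: (canRL (scalerK p2)).
  rewrite -[t' * _]mulr1 -tt' mulrA -[t' * f * t]mulrA.
  by rewrite scalerAl scalerAr -tf mulrA t't mul1r.
have step k Y : e * X k = X k * e + Y ->
    f * Y - (w / p ^+ (k + k)) *: (Y * f) = adcoef k *: (X k * t') ->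
    e * X k.+1 - X k.+1 * e = adcoef k.+1 *: (X k * t').
  move=> eY YE; rewrite /= (commutator_step _ efE eY) [Y * f + _]addrC.
  rewrite [_ *: (_ * _ + _)]scalerDr opprD addrACA YE.
  rewrite -scalerAl -scalerAr mulrBl mulrBr adstring_wt adstring_wtV adcoefS -/c.
  rewrite scalerDl addrC; congr (_ + _).
  set z := w / _.
  rewrite !scalerBr !scalerA [z * c]mulrC opprB addrA.
  by rewrite [_ + _ *: (_ * t')]addrC addrA [X in X - _]addrAC addrK -scalerBl mulrBr.
elim: m => [|m IH].
  apply: (step 0%N 0); first by rewrite addr0.
  by rewrite /adcoef qnum0 !(mul0r, mulr0, scaler0, scale0r, subr0).
apply: (step m.+1 (adcoef m.+1 *: (X m * t'))); first by rewrite -IH addrC subrK.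
rewrite -scalerAr -scalerAl -mulrA t'f -scalerAr !scalerA [_ * adcoef _]mulrC.
rewrite -[_ * _ * p ^+ 2]mulrA -[(adcoef _ * _) *: _]scalerA -scalerBr; congr (_ *: _).
rewrite /= mulrBl -scalerAl !mulrA; congr (_ - _ *: _).
by rewrite addSn addnS -addn2 exprD; field; rewrite p0 expf_neq0.
Qed.
End AdjointString.

(** * Cartan data and Serre elements *)

Section DualEval.
Variables (P : zmodType).
Implicit Types (k l : dual P).

Lemma dualDE k l x : dual_fun (k + l) x = k x + l x. Proof. by []. Qed.
Lemma dualNE k x : dual_fun (- k) x = - k x. Proof. by []. Qed.
Lemma dualMnE k n x : dual_fun (k *+ n) x = k x *+ n.
Proof.
elim: n => [|n IH] //.
rewrite [RHS]mulrS -IH mulrS.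
by [].
Qed.
End DualEval.

Section Drinfeld.
Variables (F : fieldType) (q : F).
Variables (I : choiceType) (P : zmodType) (D : cartan_datum I P).
Hypothesis q0 : q != 0.
Hypothesis q1 : forall n, (0 < n)%N -> q ^+ n != 1.
Notation a := (cartan D).
Notation alpha := (alpha D).
Notation h := (coroot D).
Notation hn := (half_norm D).
Notation qi := (qi q D).

Lemma form_half_norm i : bilform D (alpha i) (alpha i) = 2 * (hn i)%:R /\ (0 < hn i)%N.
Proof.
case: (form_alpha D i) => m m0 mE; rewrite /half_norm mE natrM [_ / 2]mulrC mulKf //.
by rewrite -[m%:R]/(m%:~R) numq_int.
Qed.

(** Both sides are [(alpha_i, alpha_j)], and the form is symmetric. *)
Lemma half_norm_sym i j : (hn i)%:Z * a i j = (hn j)%:Z * a j i.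
Proof.
have key k l : ((hn k)%:Z * a k l)%:~R = bilform D (alpha k) (alpha l) :> rat.
  have [fE h0] := form_half_norm k; have := coroot_form D k (alpha l).
  rewrite coroot_alpha fE intrM => ->.
  have h0' : (hn k)%:R != 0 :> rat by rewrite pnatr_eq0 -lt0n.
  by rewrite -pmulrn; field; rewrite h0'.
by apply: (@intr_inj rat); rewrite !key form_sym.
Qed.

Lemma qi_neq0 i : qi i != 0. Proof. exact: expf_neq0. Qed.

Lemma qi_order i n : (0 < n)%N -> qi i ^+ n != 1.
Proof. by move=> n0; rewrite -exprM q1 // muln_gt0 n0 (form_half_norm i).2. Qed.

Lemma qint_qnum i n : qint q D i n = qnum (qi i) n.
Proof. by rewrite qnum.unlock. Qed.

Lemma qfact_qnum_fact i n : qfact q D i n = qnum_fact (qi i) n.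
Proof. by apply: eq_bigr => k _; rewrite qint_qnum. Qed.

Lemma divpow_qpow (A : lalgType F) i (z : A) n : divpow q D i z n = qpow (qi i) z n.
Proof. by rewrite qpow.unlock /divpow qfact_qnum_fact. Qed.

(** The Serre sum over any algebra, since it is also needed for operators on the free algebra and in
    the opposite algebra. *)
Definition gserre (A : lalgType F) (z : I -> A) (i j : I) : A :=
  let n := `|1 - a i j|%N in
  \sum_(s < n.+1)
    (-1) ^+ s *: (divpow q D i (z i) s * z j * divpow q D i (z i) (n - s)).

Lemma gserre_morph (A B : lalgType F) (phi : A -> B) (z : I -> A) i j :
  phi 1 = 1 -> {morph phi : x y / x + y} -> {morph phi : x y / x * y} ->
  (forall c x, phi (c *: x) = c *: phi x) ->
  phi (gserre z i j) = gserre (fun k => phi (z k)) i j.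
Proof.
move=> f1 fD fM fZ; have f0 : phi 0 = 0 by rewrite -(scale0r 0) fZ scale0r.
have fX x n : phi (x ^+ n) = phi x ^+ n by elim: n => [|n IH]; rewrite // !exprS fM IH.
rewrite /gserre (big_morph _ fD f0); apply: eq_bigr => s _.
by rewrite fZ !fM /divpow !fZ !fX.
Qed.

Definition neg_cartan i j : nat := `|- a i j|%N.

Lemma cartanE i j : i != j -> a i j = - (neg_cartan i j)%:Z.
Proof.
move=> /eqP ij; have := gcm_offdiag (cartan_gcm D) ij.
by rewrite /neg_cartan; case: (a i j) => -[|n].
Qed.

(** With [w = q_i^N] and [m = N + 1] the parameter [w q_i / q_i^m] is 1, so only signs remain in the
    closed form. It is the Serre sum read backwards, whence the factor [(-1)^(N+1)]. *)
Lemma gserre_adstring (A : algType F) (z : I -> A) i j : i != j ->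
  gserre z i j = ((-1) ^+ (neg_cartan i j).+1 / qnum_fact (qi i) (neg_cartan i j).+1)
    *: adstring (qi i) (z i) (z j) (qi i ^+ neg_cartan i j) (neg_cartan i j).+1.
Proof.
move=> ij; set N := neg_cartan i j.
have nE : `|1 - a i j|%N = N.+1 by rewrite cartanE // opprK.
have qf0 := qnum_fact_neq0 (qi_neq0 i) (qi_order i) N.+1.
rewrite adstringE //; [| exact: qi_neq0 | exact: qi_order].
rewrite -exprSr mulfV ?expf_neq0 ?qi_neq0 // scalerA mulfVK // /gserre nE.
rewrite /qsum scaler_sumr (reindex_inj rev_ord_inj) /=; apply: eq_bigr => s _.
rewrite !divpow_qpow subSS subKn; last by rewrite -ltnS.
rewrite expr1n mulr1 scalerA; congr (_ *: _).
case: s => s /= sm; rewrite -[X in _ = (-1) ^+ X * _](subnK (sm : s <= N.+1)%N).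
by rewrite exprD -mulrA -expr2 sqrr_sign mulr1.
Qed.

End Drinfeld.

(** * Serre elements commute with the opposite generators *)

Section Vanishing.
Variables (F : fieldType) (p : F).
Hypothesis p0 : p != 0.
Hypothesis p1 : forall n, (0 < n)%N -> p ^+ n != 1.

(* The expansion of an iterated q-commutator in the commutative algebra [F]:
   one of the factors [1 - w / p^(2l)] vanishes. *)
Lemma qbinomial_vanish w l m : (l < m)%N -> w = p ^+ (l + l) ->
  \sum_(s < m.+1) (-1) ^+ s * (w * p / p ^+ m) ^+ s *
     ((qnum_fact p (m - s))^-1 * (qnum_fact p s)^-1) = 0.
Proof.
move=> lm wE; have X0 : adstring p (1 : F^o) 1 w m = 0.
  elim: m lm => [//|m IH] /=; rewrite ltnS leq_eqVlt => /predU1P[<-|/IH ->].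
    by rewrite wE mulfV ?expf_neq0 // scale1r mulr1 mul1r subrr.
  by rewrite mulr0 mul0r scaler0 subrr.
move/eqP: X0; rewrite adstringE // scaler_eq0 (negPf (qnum_fact_neq0 p0 p1 m)) /=.
move=> /eqP X0; rewrite -[RHS]X0 /qsum; apply: eq_bigr => s _.
by rewrite qpow.unlock !expr1n mulr1 -[_ *: 1]/(_ * 1) -[_ *: 1]/(_ * 1) !mulr1.
Qed.

Variables (A : algType F) (e f t t' y : A) (N : nat) (c : F).
Hypothesis ef : e * f = f * e.
Hypothesis ey : e * y - y * e = c *: (t - t').
Hypothesis tf : t * f = p ^+ N *: (f * t).
Hypothesis t'f : t' * f = p ^- N *: (f * t').

Lemma comm_exp (z w : A) n : z * w = w * z -> z * w ^+ n = w ^+ n * z.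
Proof.
by move=> zw; elim: n => [|n IH]; rewrite ?expr0 ?mulr1 ?mul1r // exprS mulrA zw -!mulrA IH.
Qed.

Lemma qcomm_exp (z w : A) k n : z * w = k *: (w * z) -> z * w ^+ n = k ^+ n *: (w ^+ n * z).
Proof.
move=> zw; elim: n => [|n IH]; first by rewrite !expr0 mulr1 mul1r scale1r.
by rewrite !exprS mulrA zw -scalerAl -[w * z * _]mulrA IH -scalerAr scalerA mulrA.
Qed.

(** This is [e_j] against the Serre element of [f_i] and [f_j]: only the letter [y = f_j]
    contributes, and moving the resulting [t] and [t'] to the right through [f^s] leaves two scalar
    q-binomial sums as coefficients. *)
Lemma comm_qsum : e * qsum p f y 1 N.+1 - qsum p f y 1 N.+1 * e = 0.
Proof.
rewrite /qsum mulr_sumr mulr_suml -sumrB.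
pose g (s : nat) := (-1) ^+ s * ((qnum_fact p (N.+1 - s))^-1 * (qnum_fact p s)^-1).
have E (s : 'I_N.+2) :
    e * (((-1) ^+ s * 1 ^+ s) *: (qpow p f (N.+1 - s) * y * qpow p f s)) -
    (((-1) ^+ s * 1 ^+ s) *: (qpow p f (N.+1 - s) * y * qpow p f s)) * e =
    (c * (g s * (p ^+ N) ^+ s)) *: (f ^+ N.+1 * t) -
    (c * (g s * (p ^- N) ^+ s)) *: (f ^+ N.+1 * t').
  rewrite expr1n mulr1 qpow.unlock -!scalerAl -!scalerAr -!scalerAl !scalerA -scalerBr.
  rewrite !mulrA (comm_exp _ ef) -[_ * f ^+ s * e]mulrA -(comm_exp s ef).
  rewrite !mulrA -[_ * e * y]mulrA -[_ * y * e]mulrA -mulrBl -mulrBr ey.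
  rewrite -scalerAr -scalerAl scalerA mulrBr mulrBl -![f ^+ _ * _ * _]mulrA.
  rewrite (qcomm_exp s tf) (qcomm_exp s t'f) -!scalerAr !mulrA -exprD.
  rewrite subnK ?leq_ord // scalerBr !scalerA /g.
  by congr (_ *: _ - _ *: _); ring.
rewrite (eq_bigr _ (fun s _ => E s)) sumrB -!scaler_suml -!mulr_sumr.
(* [p^N = w p / p^(N+1)] for [w = p^(2N)], so the vanishing factor is [l = N]; the second sum, in
   [p^-N], comes from [w = 1] and [l = 0]. *)
have -> : \sum_(s < N.+2) g s * (p ^+ N) ^+ s = 0.
  rewrite -[RHS](@qbinomial_vanish (p ^+ (N + N)) N N.+1) //; apply: eq_bigr => s _.
  rewrite /g mulrAC; congr (_ * _ ^+ _ * _); rewrite exprD exprS.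
  by field; rewrite p0 expf_neq0.
have -> : \sum_(s < N.+2) g s * (p ^- N) ^+ s = 0.
  rewrite -[RHS](@qbinomial_vanish 1 0 N.+1) ?expr0 //; apply: eq_bigr => s _.
  rewrite /g mulrAC; congr (_ * _ ^+ _ * _); rewrite exprS.
  by field; rewrite p0 expf_neq0.
by rewrite mulr0 !scale0r subrr.
Qed.
End Vanishing.

Section DrinfeldRelations.
Variables (F : fieldType) (q : F).
Variables (I : choiceType) (P : zmodType) (D : cartan_datum I P).
Hypothesis q0 : q != 0.
Hypothesis q1 : forall n, (0 < n)%N -> q ^+ n != 1.
Notation a := (cartan D).
Notation alpha := (alpha D).
Notation h := (coroot D).
Notation hn := (half_norm D).
Notation qi := (qi q D).
Notation ncart := (neg_cartan D).
Notation gserre := (gserre q D).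
Notation p0 := (qi_neq0 D q0).
Notation p1 := (@qi_order F q I P D q1).

Definition hcheck i : dual P := h i *+ hn i.

(** All defining relations except the Serre relations. It is instantiated by [U_q(g)], by an
    opposite algebra, and by the operators on the free algebra, where the Serre relations in the
    [f_j] are not yet imposed. *)
Record drinfeld (A : algType F) (e f : I -> A) (K : dual P -> A) : Prop := {
  drK0 : K 0 = 1;
  drKD : forall k l, K k * K l = K (k + l);
  drKe : forall k i, K k * e i * K (- k) = q ^ (k (alpha i)) *: e i;
  drKf : forall k i, K k * f i * K (- k) = q ^ (- k (alpha i)) *: f i;
  dref : forall i j, e i * f j - f j * e i =
    if i == j then (qi i - (qi i)^-1)^-1 *: (K (hcheck i) - K (- hcheck i)) else 0
}.

Section Theory.
Variables (A : algType F) (e f : I -> A) (K : dual P -> A).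
Hypothesis dr : drinfeld e f K.

Lemma drKV k : K k * K (- k) = 1.
Proof. by rewrite (drKD dr) subrr (drK0 dr). Qed.

Lemma drVK k : K (- k) * K k = 1.
Proof. by rewrite (drKD dr) addNr (drK0 dr). Qed.

Lemma drKe_comm k i : K k * e i = q ^ (k (alpha i)) *: (e i * K k).
Proof. by rewrite scalerAl -(drKe dr) -[_ * K (- k) * K k]mulrA drVK mulr1. Qed.

Lemma drKf_comm k i : K k * f i = q ^ (- k (alpha i)) *: (f i * K k).
Proof. by rewrite scalerAl -(drKf dr) -[_ * K (- k) * K k]mulrA drVK mulr1. Qed.

Lemma hcheck_alpha i j : q ^ (hcheck i (alpha j)) = qi i ^ a i j.
Proof.
by rewrite /hcheck dualMnE coroot_alpha /qi exprnP exprz_exp pmulrn mulrzz mulrC.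
Qed.

Lemma hcheck_alphaN i j : q ^ (- hcheck i (alpha j)) = qi i ^ (- a i j).
Proof.
by rewrite /hcheck dualMnE coroot_alpha /qi exprnP exprz_exp pmulrn mulrzz -mulNr mulrC.
Qed.

Lemma qi_cartan_sym i j : qi i ^ a i j = qi j ^ a j i.
Proof. by rewrite /qi !exprnP !exprz_exp half_norm_sym. Qed.

Lemma dre_commute i j : i != j -> e i * f j = f j * e i.
Proof. by move=> ij; apply/eqP; rewrite -subr_eq0 (dref dr) (negPf ij). Qed.

Lemma dr_sl2 i :
  [/\ K (hcheck i) * e i = qi i ^+ 2 *: (e i * K (hcheck i)),
      K (hcheck i) * f i = qi i ^- 2 *: (f i * K (hcheck i)) &
      e i * f i - f i * e i =
        (qi i - (qi i)^-1)^-1 *: (K (hcheck i) - K (- hcheck i))].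
Proof.
split; last by rewrite (dref dr) eqxx.
  by rewrite drKe_comm hcheck_alpha (gcm_diag (cartan_gcm D)).
by rewrite drKf_comm hcheck_alphaN (gcm_diag (cartan_gcm D)).
Qed.

Lemma dr_highest i j : i != j ->
  K (hcheck i) * f j = qi i ^+ ncart i j *: (f j * K (hcheck i)).
Proof. by move=> ij; rewrite drKf_comm hcheck_alphaN (cartanE D ij) opprK. Qed.

Lemma drKf_string k i j w m : exists c,
  K k * adstring (qi i) (f i) (f j) w m =
  c *: (adstring (qi i) (f i) (f j) w m * K k).
Proof.
set X := adstring _ _ _ _.
suff : K k * X m = q ^ (- k (alpha j)) * (q ^ (- k (alpha i))) ^+ m *: (X m * K k).
  by exists (q ^ (- k (alpha j)) * (q ^ (- k (alpha i))) ^+ m).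
elim: m => [|m IH]; first by rewrite expr0 mulr1 -drKf_comm.
rewrite /X /= -/X exprSr mulrA; set d := q ^ _ * _ in IH *.
set b := q ^ (- k (alpha i)).
have fX : K k * (f i * X m) = (d * b) *: (f i * X m * K k).
  rewrite mulrA drKf_comm -scalerAl -[f i * K k * _]mulrA IH -scalerAr scalerA.
  by rewrite [f i * (_ * _)]mulrA [_ * d]mulrC.
have Xf : K k * (X m * f i) = (d * b) *: (X m * f i * K k).
  by rewrite mulrA IH -scalerAl -[_ * K k * _]mulrA drKf_comm -scalerAr scalerA mulrA.
rewrite mulrBr mulrBl -scalerAr fX Xf scalerBr -scalerAl.
by rewrite !scalerA [_ * (d * b)]mulrC.
Qed.

Lemma drK_serre k i j : i != j -> exists c,
  K k * gserre f i j = c *: (gserre f i j * K k).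
Proof.
move=> ij; rewrite (gserre_adstring D q0 q1 f ij).
have [c cE] := drKf_string k i j (qi i ^+ ncart i j) (ncart i j).+1.
by exists c; rewrite -scalerAr cE -scalerAl !scalerA [_ * c]mulrC.
Qed.

(** For [l = i] the commutator carries the sl_2 coefficient at [m = N + 1], which is 0. For [l = j]
    it is [comm_qsum], where [q_i^(a_ij) = q_j^(a_ji)] expresses the commutation of [t_j] with [f_i]
    in powers of [q_i]. Any other [e_l] commutes with both letters. *)
Lemma dre_serre l i j : i != j -> e l * gserre f i j = gserre f i j * e l.
Proof.
move=> ij; apply/eqP; rewrite -subr_eq0; apply/eqP.
rewrite (gserre_adstring D q0 q1 f ij) -scalerAl -scalerAr -scalerBr.
apply/eqP; rewrite scaler_eq0; apply/orP; right; apply/eqP.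
have [->|li] := eqVneq l i.
  have [te tf ef] := dr_sl2 i.
  rewrite (adstring_e (p0 i) (@p1 i) (drKV _) (drVK _) tf ef _ (dr_highest ij)) ?expf_neq0 ?p0 //.
    rewrite /adcoef -exprSr mulfV ?expf_neq0 ?p0 // invr1 subrr mul0r mulr0.
    by rewrite scale0r.
  exact: dre_commute.
have [->|lj] := eqVneq l j; last first.
  have ef := dre_commute li; have ef' := dre_commute lj.
  elim: (_.+1) => [|m IH] /=; first by rewrite ef' subrr.
  move/eqP: IH; rewrite subr_eq0 => /eqP IH.
  rewrite mulrBr mulrBl -scalerAr -scalerAl !mulrA ef IH -!mulrA ef IH.
  by rewrite subrr.
have ji : j != i by rewrite eq_sym.
have [_ _ ef] := dr_sl2 j.
rewrite adstringE ?p0 // -?exprSr ?mulfV ?expf_neq0 ?p0 //; last exact: p1.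
rewrite -scalerAl -scalerAr -scalerBr (comm_qsum (p0 i) (@p1 i) (dre_commute ji) ef) ?scaler0 //.
  by rewrite drKf_comm hcheck_alphaN -invr_expz qi_cartan_sym invr_expz (cartanE D ij) opprK.
rewrite drKf_comm dualNE opprK hcheck_alpha qi_cartan_sym (cartanE D ij).
by rewrite -invr_expz.
Qed.
End Theory.

(** The Chevalley involution; it carries statements about Serre elements in the [f_j] over to those
    in the [e_j]. *)
Lemma drinfeld_swap (A : algType F) (e f : I -> A) (K : dual P -> A) :
  drinfeld e f K -> drinfeld f e (fun k => K (- k)).
Proof.
move=> dr; split=> [|k l|k i|k i|i j].
- by rewrite oppr0 (drK0 dr).
- by rewrite (drKD dr) opprD.
- by rewrite (drKf dr) dualNE opprK.
- by rewrite (drKe dr) dualNE.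
rewrite -opprB (dref dr) eq_sym; case: eqP => [->|_]; last by rewrite oppr0.
by rewrite -scalerN opprB opprK.
Qed.

Lemma drf_serre (A : algType F) (e f : I -> A) (K : dual P -> A) l i j :
  drinfeld e f K -> i != j -> f l * gserre e i j = gserre e i j * f l.
Proof. by move=> /drinfeld_swap dr ij; exact: (dre_serre dr). Qed.

End DrinfeldRelations.

(** * Free algebras and endomorphism algebras *)

HB.lock Definition word (F : fieldType) (X : choiceType) (s : seq X) :
  {malg F[{fmonom X}]} := << FMonom s >>.

Section FreeAlgebra.
Variables (F : fieldType) (X : choiceType).
Notation fr := {malg F[{fmonom X}]}.

Notation word := (@word F X).

Lemma word_nil : word [::] = 1.
Proof. by rewrite word.unlock -fmoneE. Qed.

Lemma word_cons g s : word (g :: s) = frvar F g * word s.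
Proof.
rewrite frvar.unlock word.unlock malgM_def fgmulUU mulr1; congr << _ >>.
by apply/eqP; rewrite fmP fmM fmU.
Qed.

Lemma word_sum (x : fr) : x = \sum_(m <- msupp x) x@_m *: word m.
Proof.
rewrite [LHS]monalgE; apply: eq_bigr => m _; rewrite word.unlock.
by apply/malgP => k; rewrite mcoeffZ !mcoeffU mulr_natr; case: m.
Qed.

Lemma fralg_ind (B : {pred fr}) : GRing.subalg_closed B ->
  (forall g, frvar F g \in B) -> forall x, x \in B.
Proof.
case=> B1 Blin BM Bg x.
have B0 : 0 \in B by rewrite -[0](addNr 1) -scaleN1r; exact: Blin.
have BZ c y : y \in B -> c *: y \in B by move=> yB; rewrite -[_ *: _]addr0; exact: Blin.
have BD y z : y \in B -> z \in B -> y + z \in B.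
  by move=> yB zB; rewrite -[y]scale1r; exact: Blin.
have Bw s : word s \in B.
  by elim: s => [|g s IH]; rewrite ?word_nil // word_cons; exact: BM.
by rewrite [x]word_sum; elim/big_ind: _ => // m _; exact: BZ.
Qed.

Variables (A : algType F) (rho : X -> A).

Definition word_eval (m : {fmonom X}) : A := \prod_(g <- (m : seq X)) rho g.

Fact word_eval_mult : monalg.mmorphism word_eval.
Proof.
split=> [m n|]; last by rewrite /word_eval fm1 big_nil.
by rewrite /word_eval fmM big_cat.
Qed.
HB.instance Definition _ :=
  monalg.isMultiplicative.Build {fmonom X} A word_eval word_eval_mult.

Definition freval : fr -> A := mmap (in_alg A) word_eval.
HB.instance Definition _ := GRing.Additive.on freval.

Fact freval_mult : GRing.multiplicative freval.
Proof.
apply: commr_mmap_is_multiplicative => g m m' /=.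
by rewrite /GRing.comm mulr_algr mulr_algl.
Qed.
HB.instance Definition _ := GRing.isMultiplicative.Build fr A freval freval_mult.

Fact freval_scalable : scalable freval.
Proof. by move=> c x; rewrite /freval mmapZ /= mulr_algl. Qed.
HB.instance Definition _ := GRing.isScalable.Build F fr A *:%R freval freval_scalable.

Lemma freval_var g : freval (frvar F g) = rho g.
Proof. by rewrite /freval frvar.unlock mmapU /= scale1r mul1r /word_eval fmU big_seq1. Qed.
End FreeAlgebra.

Section Endomorphisms.
Variables (F : fieldType) (V : lalgType F).

(** The unit of [V] guarantees [V != 0], so that the endomorphisms form a nonzero ring. *)
Record endo : Type := Endo { endo_fun :> V -> V; endo_linear : linear endo_fun }.

HB.instance Definition _ := gen_eqMixin endo.
HB.instance Definition _ := gen_choiceMixin endo.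

Lemma endoP (f g : endo) : f =1 g -> f = g.
Proof.
case: f => f lf; case: g => g lg /= /funext fg.
by case: _ / fg in lg *; rewrite (Prop_irrelevance lf lg).
Qed.

HB.instance Definition _ (f : endo) := GRing.isLinear.Build F V V *:%R f (endo_linear f).

Fact endo0_linear : linear (fun _ : V => 0 : V).
Proof. by move=> c x y; rewrite scaler0 addr0. Qed.
Definition endo0 := Endo endo0_linear.

Fact endo1_linear : linear (fun v : V => v). Proof. by []. Qed.
Definition endo1 := Endo endo1_linear.

Fact endoD_linear (f g : endo) : linear (fun v => f v + g v).
Proof. by move=> c x y; rewrite !linearP scalerDr addrACA. Qed.
Definition endoD f g := Endo (endoD_linear f g).

Fact endoZ_linear c (f : endo) : linear (fun v => c *: f v).
Proof. by move=> b x y; rewrite linearP scalerDr !scalerA mulrC. Qed.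
Definition endoZ c f := Endo (endoZ_linear c f).

Fact endoM_linear (f g : endo) : linear (fun v => f (g v)).
Proof. by move=> c x y; rewrite !linearP. Qed.
Definition endoM f g := Endo (endoM_linear f g).

Fact endoDA : associative endoD.
Proof. by move=> f g k; apply: endoP => x /=; rewrite addrA. Qed.
Fact endoDC : commutative endoD.
Proof. by move=> f g; apply: endoP => x /=; rewrite addrC. Qed.
Fact endo0D : left_id endo0 endoD.
Proof. by move=> f; apply: endoP => x /=; rewrite add0r. Qed.
Fact endoND : left_inverse endo0 (endoZ (-1)) endoD.
Proof. by move=> f; apply: endoP => x /=; rewrite scaleN1r addNr. Qed.
HB.instance Definition _ := GRing.isZmodule.Build endo endoDA endoDC endo0D endoND.

Fact endoZA a b f : endoZ a (endoZ b f) = endoZ (a * b) f.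
Proof. by apply: endoP => x /=; rewrite scalerA. Qed.
Fact endoZ1 : left_id 1 endoZ.
Proof. by move=> f; apply: endoP => x /=; rewrite scale1r. Qed.
Fact endoZDr : right_distributive endoZ +%R.
Proof. by move=> c f g; apply: endoP => x /=; rewrite scalerDr. Qed.
Fact endoZDl f : {morph endoZ^~ f : a b / a + b}.
Proof. by move=> a b; apply: endoP => x /=; rewrite scalerDl. Qed.
HB.instance Definition _ := GRing.Zmodule_isLmodule.Build F endo
  endoZA endoZ1 endoZDr endoZDl.

Fact endoMA : associative endoM. Proof. by move=> f g k; apply: endoP. Qed.
Fact endo1M : left_id endo1 endoM. Proof. by move=> f; apply: endoP. Qed.
Fact endoM1 : right_id endo1 endoM. Proof. by move=> f; apply: endoP. Qed.
Fact endoMDl : left_distributive endoM +%R.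
Proof. by move=> f g k; apply: endoP. Qed.
Fact endoMDr : right_distributive endoM +%R.
Proof. by move=> f g k; apply: endoP => x /=; rewrite linearD. Qed.
Fact endo1_neq0 : endo1 != 0.
Proof.
apply/eqP => /(congr1 (fun f : endo => f 1)) /= /eqP.
by rewrite oner_eq0.
Qed.
HB.instance Definition _ := GRing.Zmodule_isNzRing.Build endo
  endoMA endo1M endoM1 endoMDl endoMDr endo1_neq0.

Fact endoZAl c (f g : endo) : c *: (f * g) = (c *: f) * g.
Proof. by apply: endoP. Qed.
HB.instance Definition _ := GRing.Lmodule_isLalgebra.Build F endo endoZAl.

Fact endoZAr c (f g : endo) : c *: (f * g) = f * (c *: g).
Proof. by apply: endoP => x /=; rewrite linearZ. Qed.
HB.instance Definition _ := GRing.Lalgebra_isAlgebra.Build F endo endoZAr.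

Lemma endoME (f g : endo) v : (f * g) v = f (g v). Proof. by []. Qed.
Lemma endoDE (f g : endo) v : (f + g) v = f v + g v. Proof. by []. Qed.
Lemma endoNE (f : endo) v : (- f) v = - f v. Proof. exact: scaleN1r. Qed.
Lemma endoZE c (f : endo) v : (c *: f) v = c *: f v. Proof. by []. Qed.
Lemma endo_scale (f : endo) c v : f (c *: v) = c *: f v. Proof. exact: linearZ. Qed.
Lemma endo_add (f : endo) u v : f (u + v) = f u + f v. Proof. exact: linearD. Qed.
Lemma endo_zero (f : endo) : f 0 = 0. Proof. exact: linear0. Qed.
End Endomorphisms.

Section Evaluation.
Variables (F : fieldType) (q : F).
Variables (I : choiceType) (P : zmodType) (D : cartan_datum I P).
Variables (A : algType F) (e f : I -> A) (K : dual P -> A).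

Definition gen_val (g : qgen I P) : A :=
  match g with inl (inl i) => e i | inl (inr i) => f i | inr k => K k end.

Definition fr_eval : fralg F I P -> A := freval gen_val.
HB.instance Definition _ := GRing.LRMorphism.on fr_eval.

Lemma fr_eval_e i : fr_eval (fe F P i) = e i. Proof. exact: freval_var. Qed.
Lemma fr_eval_f i : fr_eval (ff F P i) = f i. Proof. exact: freval_var. Qed.
Lemma fr_eval_K k : fr_eval (fK F I k) = K k. Proof. exact: freval_var. Qed.

Lemma fr_evalD x y : fr_eval (x + y) = fr_eval x + fr_eval y. Proof. exact: raddfD. Qed.
Lemma fr_eval0 : fr_eval 0 = 0. Proof. exact: raddf0. Qed.
Lemma fr_evalB x y : fr_eval (x - y) = fr_eval x - fr_eval y. Proof. exact: raddfB. Qed.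
Lemma fr_evalM x y : fr_eval (x * y) = fr_eval x * fr_eval y. Proof. exact: rmorphM. Qed.
Lemma fr_evalZ c x : fr_eval (c *: x) = c *: fr_eval x. Proof. exact: linearZ. Qed.
Lemma fr_eval1 : fr_eval 1 = 1. Proof. exact: rmorph1. Qed.

Lemma fr_eval_serre (z : I -> fralg F I P) i j :
  fr_eval (fserre q D z i j) = gserre q D (fun k => fr_eval (z k)) i j.
Proof. exact: gserre_morph fr_eval1 fr_evalD fr_evalM fr_evalZ. Qed.

(** A property [Q] replaces vanishing because on the free algebra the Serre elements in the [f_j] do
    not act by zero, but map into [serre_sub]. *)
Lemma relator_eval (Q : A -> Prop) r : drinfeld q D e f K -> relator q D r -> Q 0 ->
  (forall i j, i != j -> Q (gserre q D e i j)) ->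
  (forall i j, i != j -> Q (gserre q D f i j)) -> Q (fr_eval r).
Proof.
move=> dr rr Q0 Qe Qf; case: rr => [|k l|k i|k i|i j|i j ij|i j ij].
- by rewrite fr_evalB fr_eval_K fr_eval1 (drK0 dr) subrr.
- by rewrite fr_evalB fr_evalM !fr_eval_K (drKD dr) subrr.
- by rewrite fr_evalB fr_evalZ !fr_evalM fr_eval_e !fr_eval_K (drKe dr) subrr.
- by rewrite fr_evalB fr_evalZ !fr_evalM fr_eval_f !fr_eval_K (drKf dr) subrr.
- rewrite fr_evalB fr_evalB !fr_evalM !fr_eval_e !fr_eval_f (dref dr).
  case: eqP => _; last by rewrite fr_eval0 subrr.
  by rewrite fr_evalZ fr_evalB !fr_eval_K subrr.
- rewrite fr_eval_serre; have -> : (fun k => fr_eval (fe F P k)) = e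
    by apply/funext => k; exact: fr_eval_e.
  exact: Qe.
- rewrite fr_eval_serre; have -> : (fun k => fr_eval (ff F P k)) = f
    by apply/funext => k; exact: fr_eval_f.
  exact: Qf.
Qed.
End Evaluation.

(** * The Verma module *)

Section Verma.
Variables (F : fieldType) (q : F).
Variables (I : choiceType) (P : zmodType) (D : cartan_datum I P).
Hypothesis q0 : q != 0.
Hypothesis q1 : forall n, (0 < n)%N -> q ^+ n != 1.
Notation alpha := (alpha D).
Notation qi := (qi q D).
Notation hcheck := (hcheck D).

(* The free algebra is kept abstract here: comparing its operations up to
   conversion would unfold the monoid algebra. *)
Variables (V : lalgType F) (var : I -> V) (word : seq I -> V).
Variables (vmul : V -> endo V) (word_op : (seq I -> V) -> endo V).
Hypothesis vmulE : forall v u, vmul v u = v * u.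
Hypothesis word_nil : word [::] = 1.
Hypothesis word_cons : forall j s, word (j :: s) = var j * word s.
Hypothesis word_opE : forall phi s, word_op phi (word s) = phi s.
Hypothesis endo_word :
  forall f g : endo V, (forall s, f (word s) = g (word s)) -> f = g.

Definition wt_char (k : dual P) (s : seq I) : F := \prod_(j <- s) q ^ (- k (alpha j)).

Definition vK (k : dual P) : endo V :=
  word_op (fun s => wt_char k s *: word s).

(** The only possible action of [e_i] on words: push it to the right through the letters with the
    relation for [[e_i, f_j]], and let it kill the empty word. *)
Fixpoint e_word (i : I) (s : seq I) : V :=
  if s is j :: s' then
    var j * e_word i s' +
    (if i == j then
       (qi i - (qi i)^-1)^-1 *: (vK (hcheck i) (word s') - vK (- hcheck i) (word s'))
     else 0)
  else 0.

Definition ve (i : I) : endo V := word_op (fun s => e_word i s).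
Definition vf (i : I) : endo V := vmul (var i).

Lemma vK_word k s : vK k (word s) = wt_char k s *: word s.
Proof. by rewrite word_opE. Qed.

Lemma vf_word i s : vf i (word s) = word (i :: s).
Proof. by rewrite /vf vmulE word_cons. Qed.

Lemma wt_charD k l s : wt_char (k + l) s = wt_char k s * wt_char l s.
Proof.
rewrite /wt_char -big_split; apply: eq_bigr => j _.
by rewrite dualDE opprD expfzDr.
Qed.

Lemma wt_char0 s : wt_char 0 s = 1.
Proof. by rewrite /wt_char big1. Qed.

Lemma wt_char_cons k j s : wt_char k (j :: s) = q ^ (- k (alpha j)) * wt_char k s.
Proof. by rewrite /wt_char big_cons. Qed.

Lemma vKD k l : vK k * vK l = vK (k + l).
Proof.
apply: endo_word => s; rewrite endoME 2!vK_word endo_scale vK_word scalerA.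
by rewrite wt_charD mulrC.
Qed.

Lemma vK0 : vK 0 = 1.
Proof. by apply: endo_word => s; rewrite vK_word wt_char0 scale1r. Qed.

Lemma vKf_comm k i : vK k * vf i = q ^ (- k (alpha i)) *: (vf i * vK k).
Proof.
apply: endo_word => s; rewrite endoZE !endoME vf_word 2!vK_word endo_scale -vf_word.
by rewrite scalerA wt_char_cons.
Qed.

Lemma ve_vf i j s : ve i (vf j (word s)) = vf j (ve i (word s)) +
    (if i == j then
       (qi i - (qi i)^-1)^-1 *: (vK (hcheck i) (word s) - vK (- hcheck i) (word s))
     else 0).
Proof. by rewrite vf_word /ve (word_opE _ (j :: s)) (word_opE _ s) /vf vmulE. Qed.

Lemma vKe_comm k i : vK k * ve i = q ^ (k (alpha i)) *: (ve i * vK k).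
Proof.
apply: endo_word => s; rewrite endoZE !endoME vK_word endo_scale scalerA.
elim: s => [|j s IH]; first by rewrite word_opE endo_zero scaler0.
have vKf v : vK k (vf j v) = q ^ (- k (alpha j)) *: vf j (vK k v).
  exact: (congr1 (fun g : endo V => g v) (vKf_comm k j)).
rewrite -vf_word ve_vf endo_add vKf IH wt_char_cons [RHS]scalerDr endo_scale scalerA.
rewrite [in RHS]mulrCA; congr (_ + _).
have [<-|_] := eqVneq i j; last by rewrite endo_zero scaler0.
rewrite !vK_word -scalerBl !endo_scale vK_word !scalerA; congr (_ *: _).
have -> : q ^ (- k (alpha i)) * (q ^ k (alpha i) * wt_char k s) = wt_char k s.
  by rewrite mulrA -expfzDr // addNr expr0z mul1r.
by ring.
Qed.

Lemma verma_drinfeld : drinfeld q D ve vf vK.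
Proof.
have VK k : vK k * vK (- k) = 1 by rewrite vKD subrr vK0.
split; [exact: vK0 | exact: vKD | | | ].
- by move=> k i; rewrite vKe_comm -scalerAl -mulrA VK mulr1.
- by move=> k i; rewrite vKf_comm -scalerAl -mulrA VK mulr1.
move=> i j; apply: endo_word => s; rewrite endoDE endoNE !endoME ve_vf addrC addKr.
by case: eqP => // _; rewrite endoZE endoDE endoNE.
Qed.

Lemma ve_vacuum i : ve i 1 = 0.
Proof. by rewrite -word_nil word_opE. Qed.

Lemma vK_vacuum k : vK k 1 = 1.
Proof. by rewrite -word_nil vK_word /wt_char big_nil scale1r. Qed.

(* [e]-Serre elements commute with all [f_j] and kill the vacuum. *)
Lemma verma_serre_e i j : i != j -> gserre q D ve i j = 0.
Proof.
move=> ij; set S := gserre _ _ _ _ _; apply: endo_word; elim=> [|k s IH].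
  rewrite word_nil /S gserre_adstring // endoZE.
  suff -> m : adstring (qi i) (ve i) (ve j) (qi i ^+ neg_cartan D i j) m 1 = 0.
    by rewrite scaler0.
  elim: m => [|m IH] /=; first exact: ve_vacuum.
  by rewrite IH ve_vacuum !endo_zero !scaler0 addr0.
have -> : S (word (k :: s)) = (S * vf k) (word s) by rewrite -vf_word.
rewrite /S -(drf_serre q0 q1 _ verma_drinfeld ij).
by rewrite endoME -/S IH endo_zero.
Qed.

Lemma gserre_vf i j v : gserre q D vf i j v = gserre q D var i j * v.
Proof.
rewrite -vmulE (gserre_morph q D) // => [|x y|x y|c x]; apply: endoP => u.
- by rewrite vmulE mul1r.
- by rewrite endoDE !vmulE mulrDl.
- by rewrite endoME !vmulE mulrA.
- by rewrite endoZE !vmulE scalerAl.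
Qed.

(** The two-sided ideal of the free algebra generated by the Serre elements, right factors being
    absorbed in the arbitrary [v]. The Verma module is [V] modulo this ideal; working with the
    predicate avoids forming the quotient. *)
Inductive serre_sub : V -> Prop :=
| ss_serre i j v : i != j -> serre_sub (gserre q D vf i j v)
| ss_f j v : serre_sub v -> serre_sub (vf j v)
| ss_0 : serre_sub 0
| ss_D u v : serre_sub u -> serre_sub v -> serre_sub (u + v)
| ss_Z c v : serre_sub v -> serre_sub (c *: v).

Lemma serre_sub_morph (B : algType F) (iota : V -> B) v :
  iota 1 = 1 -> {morph iota : x y / x + y} -> {morph iota : x y / x * y} ->
  (forall c x, iota (c *: x) = c *: iota x) ->
  (forall i j, i != j -> gserre q D (fun k => iota (var k)) i j = 0) ->
  serre_sub v -> iota v = 0.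
Proof.
move=> i1 iD iM iZ iS.
elim=> [i j {}v ij|j {}v _ IH||u {}v _ IHu _ IHv|c {}v _ IH].
- by rewrite gserre_vf iM (gserre_morph q D _ _ _ i1 iD iM iZ) iS // mul0r.
- by rewrite /vf vmulE iM IH mulr0.
- by rewrite -[0](scale0r 0) iZ scale0r.
- by rewrite iD IHu IHv addr0.
- by rewrite iZ IH scaler0.
Qed.

Lemma ss_K k v : serre_sub v -> serre_sub (vK k v).
Proof.
elim=> [i j {}v ij|j {}v _ IH||u {}v _ IHu _ IHv|c {}v _ IH].
- rewrite -endoME; have [c ->] := drK_serre q0 q1 verma_drinfeld k ij.
  by rewrite endoZE endoME; apply: ss_Z; exact: ss_serre.
- by rewrite -endoME vKf_comm endoZE endoME; apply: ss_Z; exact: ss_f.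
- by rewrite endo_zero; exact: ss_0.
- by rewrite endo_add; exact: ss_D.
- by rewrite endo_scale; exact: ss_Z.
Qed.

(** On a generator [e_l] passes the Serre element and lands on the arbitrary right factor; passing a
    letter [f_j] costs only a combination of the [vK], which preserve the ideal by [ss_K]. *)
Lemma ss_e l v : serre_sub v -> serre_sub (ve l v).
Proof.
elim=> [i j {}v ij|j {}v vS IH||u {}v _ IHu _ IHv|c {}v _ IH].
- by rewrite -endoME (dre_serre q0 q1 verma_drinfeld l ij) endoME; exact: ss_serre.
- have /(congr1 (fun g : endo V => g v + vf j (ve l v))) := dref verma_drinfeld l j.
  rewrite endoDE endoNE !endoME subrK => ->; apply: ss_D; last exact: ss_f.
  case: eqP => _; last exact: ss_0.
  rewrite endoZE endoDE endoNE; apply: ss_Z; apply: ss_D; first exact: ss_K.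
  by rewrite -scaleN1r; apply: ss_Z; exact: ss_K.
- by rewrite endo_zero; exact: ss_0.
- by rewrite endo_add; exact: ss_D.
- by rewrite endo_scale; exact: ss_Z.
Qed.

Definition verma_act : fralg F I P -> endo V := fr_eval ve vf vK.

Lemma verma_act_stable x v : serre_sub v -> serre_sub (verma_act x v).
Proof.
pose B : {pred fralg F I P} := fun y =>
  `[< forall u, serre_sub u -> serre_sub (verma_act y u) >].
suff /asboolP : x \in B by exact.
apply: fralg_ind => [|g]; last first.
  apply/asboolP => u uS; rewrite /verma_act /fr_eval freval_var.
  by case: g => [[i|i]|k] /=; [exact: ss_e|exact: ss_f|exact: ss_K].
split=> [|c y z /asboolP By /asboolP Bz|y z /asboolP By /asboolP Bz]; apply/asboolP => u uS.
- by rewrite /verma_act fr_eval1.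
- rewrite /verma_act fr_evalD fr_evalZ endoDE endoZE.
  by apply: ss_D; [apply: ss_Z; exact: By|exact: Bz].
- by rewrite /verma_act fr_evalM endoME; apply: By; exact: Bz.
Qed.

(** This says that [V] modulo [serre_sub] is a module over [U_q(g)]: relators act into the ideal,
    and the action of the free algebra preserves it. *)
Lemma verma_act_ideal x v : two_sided q D x -> serre_sub (verma_act x v).
Proof.
move=> xJ; elim: xJ v => [{}x xr||y z _ IHy _ IHz|y z w _ IH] v.
- apply: (@relator_eval _ q _ _ D _ ve vf vK (fun g => serre_sub (g v)) x verma_drinfeld xr).
  + exact: ss_0.
  + by move=> i j ij; rewrite verma_serre_e //; exact: ss_0.
  + by move=> i j ij; exact: ss_serre.
- by rewrite /verma_act fr_eval0; exact: ss_0.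
- by rewrite /verma_act fr_evalD endoDE; exact: ss_D.
- rewrite /verma_act !fr_evalM !endoME; apply: verma_act_stable; exact: IH.
Qed.

End Verma.

Section WordExtension.
Variables (F : fieldType) (I : choiceType).
Notation V := ({malg F[{fmonom I}]} : lalgType F).

Definition word_ext (phi : {fmonom I} -> V) : V -> V := mmap (@malgC _ F) phi.

Fact word_ext_linear phi : linear (word_ext phi).
Proof.
move=> c u v; rewrite /word_ext mmapD; congr (_ + _).
rewrite (mmapEw (msuppZ_le _ _)) mmapE scaler_sumr.
by apply: eq_bigr => m _; rewrite mcoeffZ !mul_malgC scalerA.
Qed.
Fact lmul_linear (v : V) : linear (fun u : V => v * u).
Proof. by move=> c x y; rewrite mulrDr malg_scaleAr. Qed.
End WordExtension.

HB.lock Definition word_op (F : fieldType) (I : choiceType)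
  (phi : {fmonom I} -> {malg F[{fmonom I}]}) :
  endo ({malg F[{fmonom I}]} : lalgType F) := Endo (word_ext_linear phi).

Lemma word_opE (F : fieldType) (I : choiceType) (phi : {fmonom I} -> {malg F[{fmonom I}]}) s :
  word_op phi (word F s) = phi (FMonom s).
Proof. by rewrite word_op.unlock /word_ext /= word.unlock mmapU mul_malgC scale1r. Qed.

HB.lock Definition vmul (F : fieldType) (I : choiceType) (v : {malg F[{fmonom I}]}) :
  endo ({malg F[{fmonom I}]} : lalgType F) := Endo (lmul_linear v).

Lemma vmulE (F : fieldType) (I : choiceType) (v u : {malg F[{fmonom I}]}) : vmul v u = v * u.
Proof. by rewrite vmul.unlock. Qed.

Lemma endo_word (F : fieldType) (I : choiceType)
  (f g : endo ({malg F[{fmonom I}]} : lalgType F)) : (forall s, f (word F s) = g (word F s)) -> f = g.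
Proof.
move=> fg; apply: endoP => v; rewrite [v]word_sum !linear_sum.
by apply: eq_bigr => m _; rewrite !linearZ /= fg.
Qed.

(** * Relations in [U_q(g)] and freeness over [U_q^-] *)

Section Uq.
Variables (F : fieldType) (q : F).
Variables (I : choiceType) (P : zmodType) (D : cartan_datum I P).
Notation Uq := (Uq q D).
Notation upi := (upi q D).
Notation Ue := (Ue q D).
Notation Uf := (Uf q D).
Notation UK := (UK q D).

Lemma upi_1 : upi 1 = 1. Proof. by []. Qed.
Lemma upi_D x y : upi (x + y) = upi x + upi y. Proof. exact: linearD. Qed.
Lemma upi_B x y : upi (x - y) = upi x - upi y. Proof. exact: linearB. Qed.
Lemma upi_Z c x : upi (c *: x) = c *: upi x. Proof. exact: linearZ. Qed.
Lemma upi_M x y : upi (x * y) = upi x * upi y. Proof. exact: upiM. Qed.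
Lemma upi_0 : upi 0 = 0. Proof. exact: linear0. Qed.

Lemma upi_eqP x y : upi x = upi y <-> two_sided q D (x - y).
Proof.
split=> [/lpi_eqP/asboolP//|xy]; apply/lpi_eqP; exact/asboolP.
Qed.

Lemma upi_relator r : relator q D r -> upi r = 0.
Proof. by move=> rr; rewrite -upi_0; apply/upi_eqP; rewrite subr0; exact: ts_rel. Qed.

Lemma Uq_drinfeld : drinfeld q D Ue Uf UK.
Proof.
split=> [|k l|k i|k i|i j].
- have /upi_relator/eqP := rel_K0 q D.
  by rewrite upi_B upi_1 subr_eq0 => /eqP.
- have /upi_relator/eqP := rel_KD q D k l.
  by rewrite upi_B upi_M subr_eq0 => /eqP.
- have /upi_relator/eqP := rel_Ke q D k i.
  by rewrite upi_B upi_Z !upi_M subr_eq0 => /eqP.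
- have /upi_relator/eqP := rel_Kf q D k i.
  by rewrite upi_B upi_Z !upi_M subr_eq0 => /eqP.
have /upi_relator/eqP := rel_ef q D i j.
rewrite 2!upi_B (upi_M (fe F P i) (ff F P j)) (upi_M (ff F P j) (fe F P i)) subr_eq0 => /eqP E.
rewrite -[LHS]/(upi (fe F P i) * upi (ff F P j) - upi (ff F P j) * upi (fe F P i)) E.
by case: eqP => _; [rewrite upi_Z upi_B | exact: upi_0].
Qed.

Lemma Uq_serre_f i j : i != j -> gserre q D Uf i j = 0.
Proof.
move=> ij; rewrite -(upi_relator (rel_serre_f q D ij)).
by rewrite (gserre_morph q D _ _ _ upi_1 upi_D upi_M upi_Z).
Qed.

Hypothesis q0 : q != 0.
Hypothesis q1 : forall n, (0 < n)%N -> q ^+ n != 1.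

(* [Z] is the annihilator of the highest weight vector of the Verma module of
   highest weight 0, which is free over [Uminus]. *)
Lemma verma_annihilator : exists Z : {pred Uq}, [/\ GRing.submod_closed Z,
  forall x y, y \in Z -> x * y \in Z, forall j, Ue j \in Z,
  forall k, UK k - 1 \in Z & forall x, x \in @Uminus F q I P D -> x \in Z -> x = 0].
Proof.
pose V := ({malg F[{fmonom I}]} : lalgType F).
pose var j := frvar F j : V.
pose vword s := word F s : V.
pose vop (phi : seq I -> V) : endo V := word_op (fun m => phi m).
have vmE (v u : V) : vmul v u = v * u by exact: vmulE.
have vnil : vword [::] = 1 by exact: word_nil.
have vcons j s : vword (j :: s) = var j * vword s by exact: word_cons.
have vopE phi s : vop phi (vword s) = phi s by exact: word_opE.
have vext (f g : endo V) : (forall s, f (vword s) = g (vword s)) -> f = g.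
  exact: endo_word.
pose S := serre_sub q D var (@vmul F I).
pose act := verma_act q D var vword (@vmul F I) vop.
have actJ x v : two_sided q D x -> S (act x v).
  exact: verma_act_ideal.
have actS x v : S v -> S (act x v) by exact: verma_act_stable.
have actD x y v : act (x + y) v = act x v + act y v by rewrite /act /verma_act fr_evalD.
have actB x y v : act (x - y) v = act x v - act y v.
  by rewrite /act /verma_act fr_evalB endoDE endoNE.
have actZ c x v : act (c *: x) v = c *: act x v by rewrite /act /verma_act fr_evalZ.
have actM x y v : act (x * y) v = act x (act y v) by rewrite /act /verma_act fr_evalM.
have act1 v : act 1 v = v by rewrite /act /verma_act fr_eval1.
have SB u v : S u -> S v -> S (u - v).
  by move=> Su Sv; rewrite -scaleN1r; apply: ss_D => //; exact: ss_Z.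
(* Membership is tested on one lift of [x] to the free algebra; [ZP] shows that any lift gives the
   same answer. *)
pose Z : {pred Uq} := fun x => `[< S (act (lrepr x) 1) >].
have ZP x : (upi x \in Z) <-> S (act x 1).
  have Sx : S (act (lrepr (upi x)) 1 - act x 1).
    by rewrite -actB; apply: actJ; apply/upi_eqP; rewrite -upi_surj.
  split=> [/asboolP ZE|ZE]; last apply/asboolP.
    by rewrite -[act x 1](subKr (act (lrepr (upi x)) 1)); exact: SB.
  by rewrite -[act _ 1](subrK (act x 1)); exact: ss_D.
exists Z; split.
- split=> [|c x y]; first by rewrite -upi_0; apply/ZP; rewrite -[0](scale0r 0) actZ scale0r;
    exact: ss_0.
  rewrite (upi_surj x) (upi_surj y) -upi_Z -upi_D => /ZP Zx /ZP Zy; apply/ZP.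
  by rewrite actD actZ; apply: ss_D => //; exact: ss_Z.
- move=> x y; rewrite (upi_surj x) (upi_surj y) -upi_M => /ZP Zy; apply/ZP.
  by rewrite actM; exact: actS.
- move=> j; apply/ZP; rewrite /act /verma_act fr_eval_e ve_vacuum //; exact: ss_0.
- move=> k; rewrite -upi_1 -upi_B; apply/ZP; rewrite actB act1 /act /verma_act fr_eval_K.
  by rewrite vK_vacuum // subrr; exact: ss_0.
move=> x xm.
pose iota : V -> Uq := freval Uf.
have iota1 : iota 1 = 1 by exact: rmorph1.
have iotaD u v : iota (u + v) = iota u + iota v by exact: raddfD.
have iotaM u v : iota (u * v) = iota u * iota v by exact: rmorphM.
have iotaZ c v : iota (c *: v) = c *: iota v by exact: linearZ.
have iota_var j : iota (var j) = Uf j by exact: freval_var.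
have iotaS v : S v -> iota v = 0.
  apply: (serre_sub_morph vmE iota1 iotaD iotaM iotaZ) => i j ij.
  have -> : (fun k => iota (var k)) = Uf by apply/funext => k; exact: iota_var.
  exact: Uq_serre_f.
have iota_onto y : y \in @Uminus F q I P D -> exists v, y = iota v.
  pose B : {pred Uq} := fun z => `[< exists v, z = iota v >].
  move=> ym; apply/asboolP; apply: (@gen_subalg_min _ _ _ B) ym.
    split=> [|c z w /asboolP[u ->] /asboolP[v ->]|z w /asboolP[u ->] /asboolP[v ->]]; apply/asboolP.
    - by exists 1.
    - by exists (c *: u + v); rewrite iotaD iotaZ.
    - by exists (u * v); rewrite iotaM.
  by move=> _ [j ->]; apply/asboolP; exists (var j).
(* The heart of freeness: a lift of [iota v] acts as left multiplication by [v], so it sends the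
   vacuum to [v]. If [iota v] is in [Z], then [v] is in [S], where [iota] vanishes. *)
have lift v : exists2 y, upi y = iota v & forall u, act y u = v * u.
  pose B : {pred V} := fun z => `[< exists2 y, upi y = iota z & forall u, act y u = z * u >].
  apply/asboolP; apply: (@fralg_ind _ _ B) => [|j].
    split=> [|c z w /asboolP[y yE ya] /asboolP[y' yE' ya']|z w /asboolP[y yE ya] /asboolP[y' yE' ya']];
      apply/asboolP.
    - by exists 1 => [|u]; rewrite ?act1 ?mul1r.
    - exists (c *: y + y') => [|u]; first by rewrite upi_D upi_Z yE yE' iotaD iotaZ.
      by rewrite actD actZ ya ya' mulrDl scalerAl.
    - exists (y * y') => [|u]; first by rewrite upi_M yE yE' iotaM.
      by rewrite actM ya' ya mulrA.
  apply/asboolP; exists (ff F P j) => [|u]; first by rewrite iota_var.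
  by rewrite /act /verma_act fr_eval_f /vf vmE.
have [v ->] := iota_onto x xm; have [y yE ya] := lift v.
by rewrite -yE => /ZP; rewrite ya mulr1 yE => /iotaS.
Qed.
End Uq.

(** * The algebra [U_i] *)

Lemma sub_regroup (V : zmodType) (s b b' c c' : V) :
  s + (b' - b) - (c' - c) = s + b' - c' - (b - c).
Proof.
by rewrite !opprB !addrA addrAC [RHS]addrAC [X in X + c = _]addrAC.
Qed.

Section Parabolic.
Variables (F : fieldType) (q : F).
Variables (I : choiceType) (P : zmodType) (D : cartan_datum I P).
Hypothesis q0 : q != 0.
Hypothesis q1 : forall n, (0 < n)%N -> q ^+ n != 1.
Notation alpha := (alpha D).
Notation hcheck := (hcheck D).
Notation qi := (qi q D).
Notation ncart := (neg_cartan D).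

(* [A] is [Uq]; it is kept abstract because comparing elements of [Uq] up to
   conversion unfolds the quotient of the free algebra. *)
Variables (A : algType F) (e f : I -> A) (K : dual P -> A).
Hypothesis dr : drinfeld q D e f K.
Implicit Types (u v x y : A) (k : dual P).

Definition Um : {pred A} := gen_subalg (fun x => exists j, x = f j).

Lemma UKV k : K k * K (- k) = 1. Proof. exact: drKV dr k. Qed.
Lemma UVK k : K (- k) * K k = 1. Proof. exact: drVK dr k. Qed.

Lemma Um_f j : f j \in Um.
Proof. by apply: mem_gen_subalg; exists j. Qed.

Definition Kconj k u : A := K k * u * K (- k).

Lemma Kconj1 k : Kconj k 1 = 1. Proof. by rewrite /Kconj mulr1 UKV. Qed.
Lemma KconjM k u v : Kconj k (u * v) = Kconj k u * Kconj k v.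
Proof. by rewrite /Kconj !mulrA -[_ * K (- k) * K k]mulrA UVK mulr1. Qed.
Lemma KconjP k c u v : Kconj k (c *: u + v) = c *: Kconj k u + Kconj k v.
Proof. by rewrite /Kconj mulrDr mulrDl -scalerAr -scalerAl. Qed.
Lemma K_Kconj k u : K k * u = Kconj k u * K k.
Proof. by rewrite /Kconj -[RHS]mulrA UVK mulr1. Qed.
Lemma Kconj_Um k u : u \in Um -> Kconj k u \in Um.
Proof.
move=> um; pose B : {pred A} := fun x => Kconj k x \in Um.
apply: (@gen_subalg_min _ _ _ B) um => [|_ [j ->]].
  split=> [|c x y xB yB|x y xB yB]; rewrite unfold_in ?Kconj1 ?KconjP ?KconjM.
  - exact: rpred1.
  - by rewrite rpredD ?rpredZ.
  - by rewrite rpredM.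
by rewrite unfold_in /Kconj (drKf dr) rpredZ ?Um_f.
Qed.

Section Index.
Variable i : I.
Notation t := (K (hcheck i)).
Notation t' := (K (- hcheck i)).

Definition par_gen x : Prop := [\/ x = e i, exists j, x = f j | exists k, x = K k].
Definition par_ann x : Prop := [\/ x = e i, x = f i | exists k, x = K k - 1].
Notation Up_mem := (gen_subalg par_gen).
Definition adf u : A := f i * u - t * u * t' * f i.
Definition ade u : A := e i * u * t - u * e i * t.
Definition adsf u : A := u * f i - f i * t * u * t'.

Let p0 := qi_neq0 D q0 i.
Let p1 := @qi_order F q I P D q1 i.

Lemma tt'E : t * t' = 1. Proof. exact: UKV. Qed.
Lemma t'tE : t' * t = 1. Proof. exact: UVK. Qed.

Lemma adfE u : adf u = f i * u - Kconj (hcheck i) u * f i.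
Proof. by []. Qed.
Lemma adeE u : ade u = (e i * u - u * e i) * t.
Proof. by rewrite /ade mulrBl. Qed.

Lemma adsfE u : adsf u = u * f i - f i * Kconj (hcheck i) u.
Proof. by rewrite /adsf /Kconj !mulrA. Qed.

Lemma adfP c u v : adf (c *: u + v) = c *: adf u + adf v.
Proof.
rewrite !adfE KconjP mulrDr mulrDl -scalerAr -scalerAl scalerBr.
by rewrite opprD addrACA.
Qed.

Lemma adeP c u v : ade (c *: u + v) = c *: ade u + ade v.
Proof.
rewrite !adeE scalerAl -mulrDl scalerBr; congr (_ * _).
by rewrite mulrDr mulrDl -scalerAr -scalerAl opprD addrACA.
Qed.

Lemma adeZ c u : ade (c *: u) = c *: ade u.
Proof. by rewrite !adeE -!scalerAr -!scalerAl -scalerBr scalerAl. Qed.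

Lemma adfM u v : adf (u * v) = adf u * v + Kconj (hcheck i) u * adf v.
Proof. by rewrite !adfE KconjM mulrBl mulrBr !mulrA addrA subrK. Qed.

Lemma adeM u v : ade (u * v) = ade u * Kconj (- hcheck i) v + u * ade v.
Proof.
rewrite !adeE /Kconj opprK !mulrA -[_ * t * t']mulrA tt'E mulr1 -!mulrDl.
by rewrite mulrBr !mulrA [_ * v in RHS]mulrBl addrA subrK.
Qed.

Lemma adf1 : adf (1 : A) = 0.
Proof. by rewrite adfE Kconj1 mul1r mulr1 subrr. Qed.
Lemma ade1 : ade (1 : A) = 0.
Proof. by rewrite adeE mul1r mulr1 subrr mul0r. Qed.

(** The commutator with [e_i] is a derivation, and moving [t] or [t'] past a right factor only
    conjugates that factor inside [Um]. Up to scalars, [a] and [b] are the two skew derivations of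
    [U_q^-] attached to [e_i]. *)
Lemma e_commutator u : u \in Um -> exists a b,
  [/\ a \in Um, b \in Um & e i * u - u * e i = a * t - b * t'].
Proof.
pose B : {pred A} := fun x => `[< x \in Um /\ exists a b,
  [/\ a \in Um, b \in Um & e i * x - x * e i = a * t - b * t'] >].
suff BE v : v \in Um -> v \in B by move=> /BE /asboolP[].
apply: gen_subalg_min => [|_ [j ->]]; last first.
  apply/asboolP; split; first exact: Um_f.
  rewrite (dref dr); case: eqP => _; last first.
    by exists 0, 0; split; rewrite ?rpred0 // !mul0r subrr.
  set c := _^-1; exists c%:A, c%:A; split; rewrite ?rpredZ ?rpred1 //.
  by rewrite -!scalerAl !mul1r scalerBr.
split=> [|c x y /asboolP[xm [a [b [am bm xE]]]] /asboolP[ym [a' [b' [am' bm' yE]]]]|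
  x y /asboolP[xm [a [b [am bm xE]]]] /asboolP[ym [a' [b' [am' bm' yE]]]]];
  apply/asboolP; split; rewrite ?rpred1 ?rpredD ?rpredZ ?rpredM //.
- by exists 0, 0; split; rewrite ?rpred0 // !mul0r subr0 mulr1 mul1r subrr.
- exists (c *: a + a'), (c *: b + b'); split; rewrite ?rpredD ?rpredZ //.
  rewrite mulrDr mulrDl -scalerAr -scalerAl opprD addrACA -scalerBr xE yE.
  by rewrite !mulrDl -!scalerAl scalerBr opprD addrACA.
exists (a * Kconj (hcheck i) y + x * a'), (b * Kconj (- hcheck i) y + x * b').
split; try by apply: rpredD; apply: rpredM => //; exact: Kconj_Um.
have -> : e i * (x * y) - x * y * e i =
    (e i * x - x * e i) * y + x * (e i * y - y * e i).
  by rewrite mulrBl mulrBr !mulrA addrA subrK.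
rewrite xE yE mulrBl mulrBr !mulrDl opprD addrACA -![_ * Kconj _ y * _]mulrA.
by rewrite -!K_Kconj !mulrA.
Qed.

(** The left ideal of [U_q(p_i)] that defines [V_i(0)], placed inside [A]: the multipliers stay in
    [U_q(p_i)], but elements can be compared with the annihilator [Z], which lives in the whole
    algebra. *)
Definition p_ideal : {pred A} := fun z =>
  `[< exists2 s : seq (A * A), (forall p, p \in s -> p.1 \in Up_mem /\ par_ann p.2) &
        z = \sum_(p <- s) p.1 * p.2 >].

Lemma p_ideal_submod : GRing.submod_closed p_ideal.
Proof.
split=> [|c x y /asboolP[s sP ->] /asboolP[r rP ->]]; apply/asboolP.
  by exists [::]; rewrite ?big_nil.
exists ([seq (c *: p.1, p.2) | p <- s] ++ r); last first.
  rewrite big_cat big_map scaler_sumr; congr (_ + _).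
  by apply: eq_bigr => p _; rewrite scalerAl.
move=> p; rewrite mem_cat => /orP[/mapP[p' /sP[pU pA] ->]|/rP//].
by split; rewrite //= rpredZ.
Qed.
HB.instance Definition _ := GRing.isSubmodClosed.Build F A p_ideal p_ideal_submod.

Lemma p_ideal_mul x y : x \in Up_mem -> y \in p_ideal -> x * y \in p_ideal.
Proof.
move=> xU /asboolP[s sP ->]; apply/asboolP; exists [seq (x * p.1, p.2) | p <- s].
  by move=> p /mapP[p' /sP[pU pA] ->]; split; rewrite //= rpredM.
by rewrite big_map mulr_sumr; apply: eq_bigr => p _; rewrite mulrA.
Qed.

Lemma p_ideal_ann v : par_ann v -> v \in p_ideal.
Proof.
move=> vA; apply/asboolP; exists [:: (1, v)].
  by move=> _ /[!inE]/eqP ->; split=> //; exact: rpred1.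
by rewrite big_seq1 mul1r.
Qed.

Lemma p_ideal_e : e i \in p_ideal. Proof. by apply: p_ideal_ann; constructor 1. Qed.
Lemma p_ideal_f : f i \in p_ideal. Proof. by apply: p_ideal_ann; constructor 2. Qed.
Lemma p_ideal_K k : K k - 1 \in p_ideal.
Proof. by apply: p_ideal_ann; constructor 3; exists k. Qed.

Lemma Up_e : e i \in Up_mem. Proof. by apply: mem_gen_subalg; constructor 1. Qed.
Lemma Up_f j : f j \in Up_mem.
Proof. by apply: mem_gen_subalg; constructor 2; exists j. Qed.
Lemma Up_K k : K k \in Up_mem.
Proof. by apply: mem_gen_subalg; constructor 3; exists k. Qed.

(* In the Verma module [Up / (Up e_i + sum_k Up (q^k - 1))], which is free over
   [Um], the ideal [p_ideal] becomes [Um f_i]. *)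
Lemma p_ideal_verma (Z : {pred A}) : GRing.submod_closed Z ->
  (forall x y, y \in Z -> x * y \in Z) -> (forall j, e j \in Z) ->
  (forall k, K k - 1 \in Z) ->
  forall x, x \in p_ideal -> exists2 y, y \in Um & x - y * f i \in Z.
Proof.
move=> [Z0 ZP] ZM Ze ZK.
have ZD x y : x \in Z -> y \in Z -> x + y \in Z.
  by move=> xZ yZ; rewrite -[x]scale1r; exact: ZP.
have ZZ c x : x \in Z -> c *: x \in Z.
  by move=> xZ; rewrite -[_ *: _]addr0; exact: ZP.
have ZB x y : x \in Z -> y \in Z -> x - y \in Z.
  by move=> xZ yZ; rewrite -scaleN1r ZD ?ZZ.
(* [N] is [Z + Um f_i]; it contains the generators of the ideal, so it remains to show that it is
   stable under [U_q(p_i)]. Only [e_i] is delicate. *)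
pose N : {pred A} := fun x => `[< exists2 y, y \in Um & x - y * f i \in Z >].
have N0 : 0 \in N by apply/asboolP; exists 0; rewrite ?rpred0 // mul0r subr0.
have NP c x y : x \in N -> y \in N -> c *: x + y \in N.
  move=> /asboolP[a am xa] /asboolP[b bm yb]; apply/asboolP; exists (c *: a + b).
    by rewrite rpredD ?rpredZ.
  by rewrite mulrDl opprD addrACA -scalerAl -scalerBr ZP.
have NZ x : x \in Z -> x \in N.
  by move=> xZ; apply/asboolP; exists 0; rewrite ?rpred0 // mul0r subr0.
have NK x k : x * K k - x \in Z by rewrite -[X in _ - X]mulr1 -mulrBr ZM.
have NU x y : x \in Up_mem -> y \in N -> x * y \in N.
  pose B : {pred A} := fun z => `[< forall y, y \in N -> z * y \in N >].
  suff BU z : z \in Up_mem -> z \in B by move=> /BU /asboolP; exact.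
  apply: gen_subalg_min => [|{}z zg].
    split=> [|c z1 z2 /asboolP B1 /asboolP B2|z1 z2 /asboolP B1 /asboolP B2];
      apply/asboolP => w wN.
    - by rewrite mul1r.
    - by rewrite mulrDl -scalerAl NP ?B1 ?B2.
    - by rewrite -mulrA B1 ?B2.
  apply/asboolP => w /asboolP[a am wa]; apply/asboolP; case: zg => [->|[j ->]|[k ->]].
  - have [b [c [bm cm bc]]] := e_commutator am.
    pose d := (qi i - (qi i)^-1)^-1.
    have [_ tf ef] := dr_sl2 dr i.
    have t'f : t' * f i = qi i ^+ 2 *: (f i * t').
      by have := drKf_comm dr (- hcheck i) i; rewrite dualNE opprK hcheck_alpha (gcm_diag (cartan_gcm D)).
    (* Modulo [Z] a factor [t] or [t'] on the far right becomes 1: [b t f_i] yields [q_i^-2 b f_i],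
       [c t' f_i] yields [q_i^2 c f_i], and the term [a (t - t')] from [[e_i, f_i]] disappears
       because the highest weight is 0. *)
    exists (qi i ^- 2 *: b - qi i ^+ 2 *: c); first by rewrite rpredB ?rpredZ.
    have -> : e i * w - (qi i ^- 2 *: b - qi i ^+ 2 *: c) * f i =
       e i * (w - a * f i) + (a * f i * e i + d *: (a * t - a * t')
       + qi i ^- 2 *: (b * f i * t - b * f i)
       - qi i ^+ 2 *: (c * f i * t' - c * f i)).
      have efE : e i * f i = f i * e i + d *: (t - t') by rewrite -ef addrC subrK.
      have eaE : e i * a = a * e i + (b * t - c * t') by rewrite -bc addrC subrK.
      have -> : e i * (w - a * f i) = e i * w - (a * f i * e i + d *: (a * t - a * t')
         + qi i ^- 2 *: (b * f i * t) - qi i ^+ 2 *: (c * f i * t')).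
        rewrite mulrBr mulrA eaE mulrDl -[a * e i * f i]mulrA efE mulrDr mulrBl.
        by rewrite -scalerAr mulrBr -!mulrA tf t'f -!scalerAr !mulrA !addrA.
      rewrite mulrBl -!scalerAl !(scalerBr (_ ^- 2)) !(scalerBr (_ ^+ 2)).
      by rewrite sub_regroup addrA subrK.
    apply: (ZD); first exact: (ZM).
    apply: (ZB); last by rewrite ZZ ?NK.
    apply: (ZD); last by rewrite ZZ ?NK.
    apply: (ZD); first by rewrite ZM.
    rewrite ZZ // -[a * t](subrK a) -addrA ZD ?NK // -opprB -scaleN1r ZZ ?NK //.
  - exists (f j * a); first by rewrite rpredM ?Um_f.
    by rewrite -mulrA -mulrBr ZM.
  - exists (q ^ (- k (alpha i)) *: Kconj k a); first by rewrite rpredZ ?Kconj_Um.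
    have -> : K k * w - (q ^ (- k (alpha i)) *: Kconj k a) * f i =
       K k * (w - a * f i) + q ^ (- k (alpha i)) *: (Kconj k a * f i * K k - Kconj k a * f i).
      rewrite mulrBr mulrA (K_Kconj k a) -[_ * K k * f i]mulrA (drKf_comm dr) -scalerAr mulrA.
      by rewrite scalerBr addrA subrK -scalerAl.
    by apply: (ZD); [exact: ZM | rewrite ZZ ?NK].
move=> _ /asboolP[s sA ->]; suff /asboolP : \sum_(p <- s) p.1 * p.2 \in N by [].
rewrite big_seq; elim/big_rec: _ => // p y ps yN; rewrite -[_ * _]scale1r.
have [pU pA] := sA p ps; apply: NP => //; apply: NU => //.
case: pA => [->|->|[k ->]]; [exact: NZ| |exact: NZ].
by apply/asboolP; exists 1; rewrite ?rpred1 // mul1r subrr.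
Qed.

(** * Strings and the subalgebra [B] they generate *)

Notation str j := (adstring (qi i) (f i) (f j) (qi i ^+ ncart i j)).

Lemma adf_string j m : j != i -> adf (str j m) = str j m.+1.
Proof.
move=> ji; have ij : i != j by rewrite eq_sym.
have [_ tf _] := dr_sl2 dr i.
rewrite adfE /= /Kconj (adstring_wt p0 tf (dr_highest dr ij)).
by rewrite -scalerAl -[str j m * t * t']mulrA tt'E mulr1 -scalerAl.
Qed.

Lemma ade_string j m : j != i ->
  ade (str j m.+1) = adcoef (qi i) (qi i ^+ ncart i j) m.+1 *: str j m.
Proof.
move=> ji; have ij : i != j by rewrite eq_sym.
have [te tf ef] := dr_sl2 dr i.
have ex := dre_commute dr ij.
rewrite adeE (adstring_e p0 p1 tt'E t'tE tf ef _ (dr_highest dr ij) ex) ?expf_neq0 //.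
by rewrite -scalerAl -mulrA t'tE mulr1.
Qed.

Lemma ade_f j : j != i -> ade (f j) = 0.
Proof.
by move=> ji; rewrite adeE (dre_commute dr) 1?eq_sym // subrr mul0r.
Qed.

Lemma adcoef_string n m : (m < n)%N ->
  adcoef (qi i) (qi i ^+ n) m.+1 = qnum (qi i) m.+1 * qnum (qi i) (n - m).
Proof.
move=> mn; rewrite /adcoef; congr (_ * _); rewrite qnum.unlock.
have -> : qi i ^+ n * qi i / qi i ^+ m.+1 = qi i ^+ (n - m) => //.
rewrite -exprSr -[in LHS](subnK (ltnW mn)) -addnS exprD mulfK ?expf_neq0 //.
Qed.

Definition Bgen x := exists j m, [/\ j != i, (m <= ncart i j)%N & x = str j m].
Notation Bi := (gen_subalg Bgen).

Lemma B_Kconj k u : u \in Bi -> Kconj k u \in Bi.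
Proof.
pose B : {pred A} := fun x => Kconj k x \in Bi.
move: u; suff BE : {subset Bi <= B} by exact: BE.
apply: gen_subalg_min => [|_ [j [m [ji mn ->]]]].
  split=> [|c x y xB yB|x y xB yB]; rewrite unfold_in ?Kconj1 ?KconjP ?KconjM.
  - exact: rpred1.
  - by rewrite rpredD ?rpredZ.
  - by rewrite rpredM.
have [c cE] := drKf_string dr k i j (qi i ^+ ncart i j) m.
rewrite unfold_in /Kconj cE -scalerAl -mulrA UKV mulr1 rpredZ // mem_gen_subalg //.
by exists j, m.
Qed.

Hypothesis serre_f : forall j l, j != l -> gserre q D f j l = 0.

(** This string element is a nonzero multiple of a Serre element, which explains the bound
    [m <= ncart i j] in [Bgen]. *)
Lemma string_top j : j != i -> str j (ncart i j).+1 = 0.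
Proof.
move=> ji; have ij : i != j by rewrite eq_sym.
have /eqP := serre_f ij; rewrite gserre_adstring // scaler_eq0 => /orP[|/eqP//].
rewrite mulf_eq0 invr_eq0 (negPf (qnum_fact_neq0 p0 p1 _)) orbF.
by rewrite signr_eq0.
Qed.

(** By [adfM] the operator is a derivation twisted by conjugation with [t], which preserves [B]. So
    only the generators matter: [adf] moves up the string and kills its top. The case of [ade] is
    parallel, moving down to [f_j], which it kills. *)
Lemma B_adf u : u \in Bi -> adf u \in Bi.
Proof.
pose B : {pred A} := fun x => (x \in Bi) && (adf x \in Bi).
suff BE : {subset Bi <= B} by move=> /BE /andP[].
apply: gen_subalg_min => [|_ [j [m [ji mn ->]]]].
  split=> [|c x y /andP[xB xB'] /andP[yB yB']|x y /andP[xB xB'] /andP[yB yB']]; apply/andP.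
  - by rewrite adf1 rpred0 rpred1.
  - by rewrite adfP; split; rewrite rpredD ?rpredZ.
  - split; first exact: rpredM.
    rewrite adfM; apply: rpredD; apply: rpredM => //.
    exact: B_Kconj.
apply/andP; split; first by apply: mem_gen_subalg; exists j, m.
rewrite adf_string //; move: mn; rewrite leq_eqVlt => /predU1P[->|mn].
  by rewrite string_top // rpred0.
by apply: mem_gen_subalg; exists j, m.+1.
Qed.

Lemma B_ade u : u \in Bi -> ade u \in Bi.
Proof.
pose B : {pred A} := fun x => (x \in Bi) && (ade x \in Bi).
suff BE : {subset Bi <= B} by move=> /BE /andP[].
apply: gen_subalg_min => [|_ [j [m [ji mn ->]]]].
  split=> [|c x y /andP[xB xB'] /andP[yB yB']|x y /andP[xB xB'] /andP[yB yB']]; apply/andP.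
  - by rewrite ade1 rpred0 rpred1.
  - by rewrite adeP; split; rewrite rpredD ?rpredZ.
  - split; first exact: rpredM.
    rewrite adeM; apply: rpredD; apply: rpredM => //.
    exact: B_Kconj.
apply/andP; split; first by apply: mem_gen_subalg; exists j, m.
case: m mn => [|m] mn; first by rewrite /= ade_f // rpred0.
rewrite ade_string // rpredZ //; apply: mem_gen_subalg; exists j, m; split=> //.
exact: ltnW.
Qed.

Lemma B_f j u : j != i -> u \in Bi -> f j * u \in Bi.
Proof.
by move=> ji uB; rewrite rpredM //; apply: mem_gen_subalg; exists j, 0%N.
Qed.

Lemma string_Um j m : str j m \in Um.
Proof.
elim: m => [|m IH] /=; first exact: Um_f.
by rewrite rpredB ?rpredZ ?rpredM ?Um_f.
Qed.

Lemma B_Um u : u \in Bi -> u \in Um.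
Proof.
apply: gen_subalg_min => [|_ [j [m [_ _ ->]]]]; first exact: gen_subalg_closed.
exact: string_Um.
Qed.

Lemma Um_Up u : u \in Um -> u \in Up_mem.
Proof.
apply: gen_subalg_min => [|_ [j ->]]; [exact: gen_subalg_closed|exact: Up_f].
Qed.

Lemma adf_mod u : u \in Um -> f i * u - adf u \in p_ideal.
Proof.
move=> um; rewrite adfE subKr p_ideal_mul ?p_ideal_f //.
by apply: Um_Up; exact: Kconj_Um.
Qed.

(** The two summands of [ade] differ from [e_i u] and from 0 by elements of the ideal: inserting [t]
    costs [e_i u (t - 1)], and [u e_i t] is [q_i^-2 u t e_i]. *)
Lemma ade_mod u : u \in Um -> e i * u - ade u \in p_ideal.
Proof.
move=> um; have uU := Um_Up um; have [te _ _] := dr_sl2 dr i.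
have -> : e i * u - ade u = qi i ^- 2 *: (u * t * e i) - (e i * u) * (t - 1).
  rewrite -[u * t * _]mulrA te -scalerAr scalerA mulVf ?expf_neq0 // scale1r.
  by rewrite /ade mulrBr mulr1 !opprB addrCA !mulrA addrA.
rewrite rpredB ?rpredZ ?p_ideal_mul ?p_ideal_e ?p_ideal_K ?rpredM ?Up_e ?Up_K //.
Qed.

Lemma Kconj_mod k u : u \in Um -> K k * u - Kconj k u \in p_ideal.
Proof.
move=> um; rewrite K_Kconj -[X in _ - X]mulr1 -mulrBr p_ideal_mul ?p_ideal_K //.
by apply: Um_Up; exact: Kconj_Um.
Qed.

Lemma Up_B x : x \in Up_mem -> exists2 u, u \in Bi & x - u \in p_ideal.
Proof.
(* Membership in [Up_mem] is carried along because [p_ideal] is stable only under left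
   multiplication by [U_q(p_i)], and this is needed for products. The case [u = 1] gives the
   claim. *)
pose Q : {pred A} := fun z => (z \in Up_mem) &&
  `[< forall u, u \in Bi -> exists2 v, v \in Bi & z * u - v \in p_ideal >].
suff QE : {subset Up_mem <= Q}.
  by move=> /QE /andP[_ /asboolP/(_ 1 (rpred1 _))]; rewrite mulr1.
apply: gen_subalg_min => [|z zg].
  split=> [|c y z /andP[yU /asboolP Qy] /andP[zU /asboolP Qz]|
           y z /andP[yU /asboolP Qy] /andP[zU /asboolP Qz]];
    apply/andP; split; rewrite ?rpred1 ?rpredD ?rpredZ ?rpredM //; apply/asboolP => u uB.
  - by exists u; rewrite ?mul1r ?subrr ?rpred0.
  - have [v vB yv] := Qy u uB; have [w wB zw] := Qz u uB.
    exists (c *: v + w); first by rewrite rpredD ?rpredZ.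
    by rewrite mulrDl opprD addrACA -scalerAl -scalerBr rpredD ?rpredZ.
  have [v vB zv] := Qz u uB; have [w wB yw] := Qy v vB.
  exists w => //; have -> : y * z * u - w = y * (z * u - v) + (y * v - w).
    by rewrite mulrBr mulrA addrA subrK.
  by rewrite rpredD // p_ideal_mul.
apply/andP; split; first exact: mem_gen_subalg.
apply/asboolP => u uB; have um := B_Um uB; case: zg => [->|[j ->]|[k ->]].
- by exists (ade u); [exact: B_ade|exact: ade_mod].
- have [->|ji] := eqVneq j i.
    by exists (adf u); [exact: B_adf|exact: adf_mod].
  by exists (f j * u); [exact: B_f|rewrite subrr rpred0].
- by exists (Kconj k u); [exact: B_Kconj|exact: Kconj_mod].
Qed.

(** * The braid automorphism and the equality of [U_i] with [B] *)

Section Braid.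
Variable T : A -> A.
Hypothesis T1 : T 1 = 1.
Hypothesis TP : linear T.
Hypothesis TM : {morph T : x y / x * y}.
Hypothesis Tbij : bijective T.
Hypothesis TK : forall k, T (K k) = K (refl D i k).
Hypothesis Tei : T (e i) = - (t' * f i).
Hypothesis Tfi : T (f i) = - (e i * t).
Hypothesis Tf : forall j, j != i -> T (f j) =
  \sum_(r < (ncart i j).+1) ((-1) ^+ r * qi i ^+ r) *:
    (divpow q D i (f i) (ncart i j - r) * f j * divpow q D i (f i) r).
Hypothesis verma : exists Z : {pred A}, [/\ GRing.submod_closed Z,
  forall x y, y \in Z -> x * y \in Z, forall j, e j \in Z,
  forall k, K k - 1 \in Z & forall x, x \in Um -> x \in Z -> x = 0].

Lemma T0 : T 0 = 0.
Proof. by have := TP (-1) 0 0; rewrite scaler0 addr0 scaleN1r addNr. Qed.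
Lemma TZ c u : T (c *: u) = c *: T u.
Proof. by have := TP c u 0; rewrite !addr0 T0 addr0. Qed.
Lemma TN u : T (- u) = - T u.
Proof. by rewrite -scaleN1r TZ scaleN1r. Qed.
Lemma TB u v : T (u - v) = T u - T v.
Proof. by rewrite addrC -scaleN1r TP scaleN1r addrC. Qed.

Lemma refl_hcheck : refl D i (hcheck i) = - hcheck i.
Proof.
rewrite /refl /hcheck dualMnE coroot_alpha (gcm_diag (cartan_gcm D)).
set n := half_norm D i; have -> : (2 : int) *+ n = (n + n)%N.
  by rewrite -mulrnA mul2n -addnn natz.
by rewrite -pmulrn mulrnDr opprD addrA subrr add0r.
Qed.

Lemma T_t : T t = t'. Proof. by rewrite TK refl_hcheck. Qed.
Lemma T_t' : T t' = t.
Proof.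
have E : T t' * t' = 1 by rewrite -[X in _ * X]T_t -TM t'tE T1.
by rewrite -[LHS]mulr1 -t'tE mulrA E mul1r.
Qed.

Lemma T_adsf u : T (adsf u) = ade (T u).
Proof.
rewrite /adsf /ade TB !TM T_t T_t' Tfi mulrN !mulNr opprK addrC.
by rewrite -[e i * t * t']mulrA tt'E mulr1 mulrA.
Qed.

(** At [m = N] and [w = q_i^N] the parameter of the closed form is [q_i], which is the factor
    [q_i^r] of the braid formula: [T_i (f_j)] is the normalized top of the string. *)
Lemma T_f j : j != i -> T (f j) = (qnum_fact (qi i) (ncart i j))^-1 *: str j (ncart i j).
Proof.
move=> ji; rewrite adstringE // scalerA mulVf ?qnum_fact_neq0 // scale1r Tf //.
rewrite /qsum; apply: eq_bigr => r _.
by rewrite !divpow_qpow [_ * qi i / _]mulrAC mulfV ?expf_neq0 // mul1r.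
Qed.

(** By [T_adsf], each [adsf] becomes an [ade] after [T], so the image walks down from the top of the
    string. The step from [m] to [m + 1] contributes [[N - m][m + 1]]. *)
Lemma T_iter_adsf j m : j != i -> (m <= ncart i j)%N ->
  T (iter m adsf (f j)) =
  (qnum_fact (qi i) m / qnum_fact (qi i) (ncart i j - m)) *: str j (ncart i j - m).
Proof.
move=> ji; elim: m => [|m IH] kn.
  by rewrite subn0 qnum_fact0 div1r T_f.
have nm : (ncart i j - m = (ncart i j - m.+1).+1)%N by rewrite subnSK.
rewrite iterS T_adsf IH; last exact: ltnW.
rewrite nm adeZ ade_string // scalerA; congr (_ *: _).
rewrite adcoef_string; last by rewrite ltn_subrL (leq_ltn_trans _ kn).
rewrite subKn //.
rewrite !qnum_factS.
have := qnum_fact_neq0 p0 p1 (ncart i j - m.+1).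
have := @qnum_neq0 _ _ p0 p1 (ncart i j - m.+1).+1 isT.
by move=> a0 b0; field; rewrite a0 b0.
Qed.

Definition Ui_pred : {pred A} := fun u =>
  (u \in Um) && `[< exists2 w, w \in Um & u = T w >].
Definition iU_pred : {pred A} := fun u => (u \in Um) && (T u \in Um).

Lemma iter_adsf_Um j m : iter m adsf (f j) \in Um.
Proof.
elim: m => [|m IH]; first exact: Um_f.
rewrite iterS adsfE; apply: rpredB; apply: rpredM; rewrite ?Um_f //.
exact: Kconj_Um.
Qed.

Lemma B_Ui u : u \in Bi -> u \in Ui_pred.
Proof.
pose B : {pred A} := fun x => `[< exists2 w, w \in Um & x = T w >].
move=> uB; apply/andP; split; first exact: B_Um.
move: u uB; apply: (@gen_subalg_min _ _ _ B) => [|_ [j [m [ji mn ->]]]].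
  split=> [|c x y /asboolP[v vm ->] /asboolP[w wm ->]|
            x y /asboolP[v vm ->] /asboolP[w wm ->]]; apply/asboolP.
  - by exists 1; rewrite ?rpred1.
  - by exists (c *: v + w); rewrite ?TP ?rpredD ?rpredZ.
  - by exists (v * w); rewrite ?TM ?rpredM.
apply/asboolP; set n := ncart i j in mn; have nm : (n - m <= n)%N by exact: leq_subr.
have := T_iter_adsf ji nm; rewrite subKn //; set c := _ / _ => TE.
have c0 : c != 0 by rewrite mulf_neq0 ?invr_neq0 ?qnum_fact_neq0.
exists (c^-1 *: iter (n - m) adsf (f j)); first by rewrite rpredZ ?iter_adsf_Um.
by rewrite TZ TE scalerA mulVf ?scale1r.
Qed.

Lemma Ui_ideal_inj u : u \in Ui_pred -> u \in p_ideal -> u = 0.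
Proof.
move=> /andP[um /asboolP[w wm uE]] uJ.
have [Z [Zs ZM Ze ZK Zm]] := verma.
have [y ym yZ] := p_ideal_verma Zs ZM Ze ZK uJ.
have uy : u = y * f i by apply/subr0_eq/Zm => //; rewrite rpredB ?rpredM ?Um_f.
have [T' TT' T'T] := Tbij.
(* Applying the inverse of [T] thus turns the right factor [f_i] of [u] into a right factor [e_i],
   which lies in [Z]. *)
have fE : f i = T (- (t' * e i)).
  by rewrite TN TM T_t' Tei mulrN opprK mulrA tt'E mul1r.
have wE : w = - (T' y * t') * e i.
  by rewrite -[LHS]TT' -uE uy -[y]T'T fE -TM TT' mulrN mulrA mulNr T'T.
have w0 : w = 0 by apply: Zm => //; rewrite wE; exact: ZM.
by rewrite uE w0 T0.
Qed.

Lemma Ui_sub x y : x \in Ui_pred -> y \in Ui_pred -> x - y \in Ui_pred.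
Proof.
move=> /andP[xm /asboolP[v vm xE]] /andP[ym /asboolP[w wm yE]].
apply/andP; split; first exact: rpredB.
by apply/asboolP; exists (v - w); rewrite ?rpredB ?TB ?xE ?yE.
Qed.

(** Some [b] in [B] has the same class as [u] in [V_i(0)], and injectivity on [U_i] forces [u = b].
    Stability of [U_i] under the operators, not visible from its definition, is inherited from [B]
    through this inclusion. *)
Lemma Ui_B u : u \in Ui_pred -> u \in Bi.
Proof.
move=> uU; have /andP[um _] := uU; have [b bB ub] := Up_B (Um_Up um).
suff /subr0_eq -> : u - b = 0 by [].
by apply: Ui_ideal_inj => //; apply: Ui_sub => //; exact: B_Ui.
Qed.

Lemma Ui_adf u : u \in Ui_pred -> adf u \in Ui_pred.
Proof. by move=> /Ui_B/B_adf/B_Ui. Qed.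
Lemma Ui_ade u : u \in Ui_pred -> ade u \in Ui_pred.
Proof. by move=> /Ui_B/B_ade/B_Ui. Qed.
Lemma Ui_f j u : j != i -> u \in Ui_pred -> f j * u \in Ui_pred.
Proof. by move=> ji /Ui_B /(B_f ji)/B_Ui. Qed.
Lemma Ui_Kconj k u : u \in Ui_pred -> Kconj k u \in Ui_pred.
Proof. by move=> /Ui_B /(B_Kconj k)/B_Ui. Qed.
Lemma Up_Ui x : x \in Up_mem -> exists2 u, u \in Ui_pred & x - u \in p_ideal.
Proof. by move=> /Up_B[u /B_Ui uU xu]; exists u. Qed.

Lemma Ui_structure :
  [/\ forall u, u \in Ui_pred -> u \in p_ideal -> u = 0,
      forall x, x \in Up_mem -> exists2 u, u \in Ui_pred & x - u \in p_ideal
    & forall u, u \in Ui_pred ->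
      [/\ adf u \in Ui_pred /\ f i * u - adf u \in p_ideal,
          ade u \in Ui_pred /\ e i * u - ade u \in p_ideal,
          forall j, j != i -> f j * u \in Ui_pred
        & forall k, Kconj k u \in Ui_pred /\ K k * u - Kconj k u \in p_ideal]].
Proof.
split=> [|| u uU]; [exact: Ui_ideal_inj|exact: Up_Ui|].
have /andP[um _] := uU; split=> [||j ji|k].
- by split; [exact: Ui_adf|exact: adf_mod].
- by split; [exact: Ui_ade|exact: ade_mod].
- exact: Ui_f.
- by split; [exact: Ui_Kconj|exact: Kconj_mod].
Qed.

(** * Right-handed statements by the antiautomorphism *)

Section Antiautomorphism.
Variable S : A -> A.
Hypothesis SP : linear S.
Hypothesis SM : forall x y, S (x * y) = S y * S x.
Hypothesis SS : involutive S.
Hypothesis Se : forall j, S (e j) = e j.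
Hypothesis Sf : forall j, S (f j) = f j.
Hypothesis SK : forall k, S (K k) = K (- k).

Definition adse u : A := t' * u * e i - t' * e i * u.

Lemma S0 : S 0 = 0.
Proof. by have := SP (-1) 0 0; rewrite scaler0 addr0 scaleN1r addNr. Qed.
Lemma SD u v : S (u + v) = S u + S v.
Proof. by have := SP 1 u v; rewrite !scale1r. Qed.
Lemma SZ c u : S (c *: u) = c *: S u.
Proof. by have := SP c u 0; rewrite !addr0 S0 addr0. Qed.
Lemma SB u v : S (u - v) = S u - S v.
Proof. by rewrite addrC -scaleN1r SP scaleN1r addrC. Qed.
Lemma S1 : S 1 = 1.
Proof. by rewrite -[LHS]mulr1 -{2}[1]SS -SM mulr1 SS. Qed.

Lemma S_adf u : S (adf u) = adsf (S u).
Proof. by rewrite /adf /adsf SB !SM !Sf !SK opprK !mulrA. Qed.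

Lemma S_ade u : S (ade u) = adse (S u).
Proof. by rewrite /ade /adse SB !SM !Se !SK !mulrA. Qed.

Lemma S_Kconj k u : S (Kconj k u) = Kconj k (S u).
Proof. by rewrite /Kconj !SM !SK opprK mulrA. Qed.

Lemma S_Um u : u \in Um -> S u \in Um.
Proof.
pose B : {pred A} := fun x => S x \in Um.
suff BE : {subset Um <= B} by exact: BE.
apply: gen_subalg_min => [|_ [j ->]]; last by rewrite unfold_in Sf Um_f.
split=> [|c x y xB yB|x y xB yB]; rewrite unfold_in ?S1 ?SP ?SM.
- exact: rpred1.
- by rewrite rpredD ?rpredZ.
- by rewrite rpredM.
Qed.

Lemma S_Up u : u \in Up_mem -> S u \in Up_mem.
Proof.
pose B : {pred A} := fun x => S x \in Up_mem.
suff BE : {subset Up_mem <= B} by exact: BE.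
apply: gen_subalg_min => [|_ [->|[j ->]|[k ->]]]; last first.
- by rewrite unfold_in SK Up_K.
- by rewrite unfold_in Sf Up_f.
- by rewrite unfold_in Se Up_e.
split=> [|c x y xB yB|x y xB yB]; rewrite unfold_in ?S1 ?SP ?SM.
- exact: rpred1.
- by rewrite rpredD ?rpredZ.
- by rewrite rpredM.
Qed.

Lemma S_string j m : j != i -> S (str j m) = iter m adsf (f j).
Proof.
by move=> ji; elim: m => [|m IH]; rewrite ?Sf // -adf_string // S_adf IH.
Qed.

(* On [Um] the inverse of [T] is [S T S]. *)
Lemma TST u : u \in Um -> T (S (T u)) = S u.
Proof.
pose B : {pred A} := fun x => T (S (T x)) == S x.
suff BE : {subset Um <= B} by move=> /BE /eqP.
apply: gen_subalg_min => [|_ [j ->]].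
  split=> [|c x y /eqP xB /eqP yB|x y /eqP xB /eqP yB]; apply/eqP.
  - by rewrite T1 S1 T1.
  - by rewrite TP !SP TP xB yB.
  - by rewrite TM !SM TM xB yB.
apply/eqP; have [->|ji] := eqVneq j i.
  rewrite Tfi -scaleN1r SZ scaleN1r SM SK Se TN TM T_t' Tei Sf.
  by rewrite mulrN opprK mulrA tt'E mul1r.
rewrite T_f // SZ S_string // TZ T_iter_adsf // subnn qnum_fact0 divr1 scalerA.
by rewrite mulVf ?qnum_fact_neq0 // scale1r Sf.
Qed.

Lemma S_iU u : u \in iU_pred -> S u \in Ui_pred.
Proof.
move=> /andP[um Tum]; apply/andP; split; first exact: S_Um.
by apply/asboolP; exists (S (T u)); rewrite ?TST // S_Um.
Qed.

Lemma S_Ui u : u \in Ui_pred -> S u \in iU_pred.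
Proof.
move=> /andP[um /asboolP[w wm uE]]; apply/andP; split; first exact: S_Um.
by rewrite uE TST // S_Um.
Qed.

Definition p_ideal_r : {pred A} := fun z =>
  `[< exists2 s : seq (A * A), (forall p, p \in s -> p.1 \in Up_mem /\ par_ann p.2) &
        z = \sum_(p <- s) p.2 * p.1 >].

Lemma p_ideal_r0 : 0 \in p_ideal_r.
Proof. by apply/asboolP; exists [::]; rewrite ?big_nil. Qed.

Lemma S_ann v : par_ann v -> par_ann (S v).
Proof.
case=> [->|->|[k ->]]; [constructor 1|constructor 2|constructor 3] => //.
by exists (- k); rewrite SB SK S1.
Qed.

Lemma S_seq (s : seq (A * A)) : (forall p, p \in s -> p.1 \in Up_mem /\ par_ann p.2) ->
  forall p, p \in [seq (S p.1, S p.2) | p <- s] -> p.1 \in Up_mem /\ par_ann p.2.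
Proof.
by move=> sP _ /mapP[p /sP[pU pA] ->]; split; [exact: S_Up|exact: S_ann].
Qed.

Lemma S_ideal_r z : z \in p_ideal_r -> S z \in p_ideal.
Proof.
move=> /asboolP[s sP ->]; apply/asboolP.
exists [seq (S p.1, S p.2) | p <- s]; first exact: S_seq.
by rewrite big_map (big_morph _ SD S0); apply: eq_bigr => p _; rewrite SM.
Qed.

Lemma S_ideal z : z \in p_ideal -> S z \in p_ideal_r.
Proof.
move=> /asboolP[s sP ->]; apply/asboolP.
exists [seq (S p.1, S p.2) | p <- s]; first exact: S_seq.
by rewrite big_map (big_morph _ SD S0); apply: eq_bigr => p _; rewrite SM.
Qed.

Lemma iU_ideal_inj u : u \in iU_pred -> u \in p_ideal_r -> u = 0.
Proof.
move=> uU uJ; rewrite -[u]SS -S0; congr (S _).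
by apply: Ui_ideal_inj; [exact: S_iU|exact: S_ideal_r].
Qed.

Lemma Up_iU x : x \in Up_mem -> exists2 u, u \in iU_pred & x - u \in p_ideal_r.
Proof.
move=> xU; have [u uU xu] := Up_Ui (S_Up xU); exists (S u); first exact: S_Ui.
by rewrite -[x - _]SS SB SS; exact: S_ideal.
Qed.

Lemma iU_adsf u : u \in iU_pred -> adsf u \in iU_pred.
Proof. by move=> uU; rewrite -[u]SS -S_adf; apply/S_Ui/Ui_adf/S_iU. Qed.
Lemma iU_adse u : u \in iU_pred -> adse u \in iU_pred.
Proof. by move=> uU; rewrite -[u]SS -S_ade; apply/S_Ui/Ui_ade/S_iU. Qed.
Lemma iU_f j u : j != i -> u \in iU_pred -> u * f j \in iU_pred.
Proof.
move=> ji uU; have -> : u * f j = S (f j * S u) by rewrite SM SS Sf.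
by apply/S_Ui/Ui_f => //; exact: S_iU.
Qed.
Lemma iU_Kconj k u : u \in iU_pred -> Kconj k u \in iU_pred.
Proof. by move=> uU; rewrite -[u]SS -S_Kconj; apply/S_Ui/Ui_Kconj/S_iU. Qed.

Lemma adsf_mod u : u \in Um -> u * f i - adsf u \in p_ideal_r.
Proof.
move=> um; have -> : u * f i - adsf u = S (f i * S u - adf (S u)).
  by rewrite SB SM S_adf SS Sf.
by apply/S_ideal/adf_mod/S_Um.
Qed.
Lemma adse_mod u : u \in Um -> u * e i - adse u \in p_ideal_r.
Proof.
move=> um; have -> : u * e i - adse u = S (e i * S u - ade (S u)).
  by rewrite SB SM S_ade SS Se.
by apply/S_ideal/ade_mod/S_Um.
Qed.
Lemma Kconj_mod_r k u : u \in Um -> u * K k - Kconj (- k) u \in p_ideal_r.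
Proof.
move=> um; have -> : u * K k - Kconj (- k) u = S (K (- k) * S u - Kconj (- k) (S u)).
  by rewrite SB SM S_Kconj SS SK opprK.
by apply/S_ideal/Kconj_mod/S_Um.
Qed.

Lemma iU_structure :
  [/\ forall u, u \in iU_pred -> u \in p_ideal_r -> u = 0,
      forall x, x \in Up_mem -> exists2 u, u \in iU_pred & x - u \in p_ideal_r
    & forall u, u \in iU_pred ->
      [/\ adsf u \in iU_pred /\ u * f i - adsf u \in p_ideal_r,
          adse u \in iU_pred /\ u * e i - adse u \in p_ideal_r,
          forall j, j != i -> u * f j \in iU_pred
        & forall k, Kconj (- k) u \in iU_pred /\ u * K k - Kconj (- k) u \in p_ideal_r]].
Proof.
split=> [|| u uU]; [exact: iU_ideal_inj|exact: Up_iU|].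
have /andP[um _] := uU; split=> [||j ji|k].
- by split; [exact: iU_adsf|exact: adsf_mod].
- by split; [exact: iU_adse|exact: adse_mod].
- exact: iU_f.
- by split; [exact: iU_Kconj|exact: Kconj_mod_r].
Qed.
End Antiautomorphism.
End Braid.
End Index.
End Parabolic.

(** * The antiautomorphism *)

Section Converse.
Variables (F : fieldType) (A : algType F).

Fact converse_scaleAl (c : F) (x y : A) : c *: (y * x) = y * (c *: x).
Proof. by rewrite scalerAr. Qed.
Fact converse_scaleAr (c : F) (x y : A) : c *: (y * x) = (c *: y) * x.
Proof. by rewrite scalerAl. Qed.

HB.instance Definition _ := GRing.Lmodule.copy (A^c)%type A.
HB.instance Definition _ := GRing.Lmodule_isLalgebra.Build F (A^c)%type converse_scaleAl.
HB.instance Definition _ := GRing.Lalgebra_isAlgebra.Build F (A^c)%type converse_scaleAr.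

End Converse.

Section ConverseDrinfeld.
Variables (F : fieldType) (q : F).
Variables (I : choiceType) (P : zmodType) (D : cartan_datum I P).
Variables (A : algType F) (e f : I -> A) (K : dual P -> A).
Hypothesis dr : drinfeld q D e f K.

(** Reversing products changes the sign of [[e_i, f_i]], and inverting the [K k] compensates it. *)
Lemma drinfeld_converse :
  drinfeld q D (A := (A^c)%type) e f (fun k => K (- k)).
Proof.
split=> [|k l|k i|k i|i j].
- by rewrite oppr0 (drK0 dr).
- by rewrite -[LHS]/(K (- l) * K (- k)) (drKD dr) opprD addrC.
- by rewrite -[LHS]/(K (- - k) * (e i * K (- k))) opprK mulrA (drKe dr).
- by rewrite -[LHS]/(K (- - k) * (f i * K (- k))) opprK mulrA (drKf dr).
rewrite -[LHS]/(f j * e i - e i * f j) -opprB (dref dr).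
case: eqP => _; last by rewrite oppr0.
by rewrite -scalerN opprB opprK.
Qed.

(** The substitution of [n - s] for [s] undoes the reversal of the factors and multiplies the signs
    by [(-1)^n]. *)
Lemma gserre_converse (z : I -> A) i j :
  gserre q D (A := (A^c)%type) z i j = (-1) ^+ `|1 - cartan D i j|%N *: gserre q D z i j.
Proof.
rewrite /gserre scaler_sumr (reindex_inj rev_ord_inj) /=.
apply: eq_bigr => s _; set n := `|_|%N; have sn : (s <= n)%N by rewrite -ltnS.
have signE : (-1) ^+ (n - s) = (-1) ^+ n * (-1) ^+ s :> F.
  by move: sn; rewrite -[(_ <= n)%N]/(nat_of_ord s <= n)%N; move: (nat_of_ord s) => r rn;
    rewrite -[in RHS](subnK rn) exprD -mulrA -expr2 sqrr_sign mulr1.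
rewrite scalerA subSS subKn // signE; congr (_ *: _).
have dE m : divpow q D (A := (A^c)%type) i (z i) m = divpow q D (A := A) i (z i) m.
  by rewrite /divpow revrX.
by rewrite !dE -mulrA.
Qed.

Hypothesis serre_e : forall i j, i != j -> gserre q D e i j = 0.
Hypothesis serre_f : forall i j, i != j -> gserre q D f i j = 0.

(** An antihomomorphism to [A] is a homomorphism to the opposite algebra; the statement is phrased
    in [A] so that the opposite structure stays inside the proof. *)
Lemma anti_eval : exists g : fralg F I P -> A, [/\ linear g,
  g 1 = 1 /\ forall x y, g (x * y) = g y * g x,
  (forall j, g (fe F P j) = e j) /\ (forall j, g (ff F P j) = f j),
  forall k, g (fK F I k) = K (- k) & forall x, two_sided q D x -> g x = 0].
Proof.
pose g : fralg F I P -> (A^c)%type := fr_eval (A := (A^c)%type) e f (fun k => K (- k)).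
exists g; split.
- by move=> c x y; rewrite /g fr_evalD fr_evalZ.
- by split=> [|x y]; [exact: (@fr_eval1 F I P (A^c)%type e f _)|rewrite /g fr_evalM].
- split=> j; first exact: (@fr_eval_e F I P (A^c)%type e f _ j).
  exact: (@fr_eval_f F I P (A^c)%type e f _ j).
- by move=> k; exact: (@fr_eval_K F I P (A^c)%type e f (fun k => K (- k)) k).
move=> x; elim=> [{}x xr||y z _ IHy _ IHz|y z w _ IH].
- apply: (@relator_eval F q I P D (A^c)%type e f (fun k => K (- k))
    (fun a => a = 0) x drinfeld_converse xr) => //.
  + by move=> i j ij; rewrite gserre_converse serre_e // scaler0.
  + by move=> i j ij; rewrite gserre_converse serre_f // scaler0.
- exact: (@fr_eval0 F I P (A^c)%type e f _).
- by rewrite /g fr_evalD -!/(g _) IHy IHz addr0.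
- by rewrite /g !fr_evalM -!/(g _) IH mulr0 mul0r.
Qed.
End ConverseDrinfeld.

Section UqAnti.
Variables (F : fieldType) (q : F).
Variables (I : choiceType) (P : zmodType) (D : cartan_datum I P).
Notation Uq := (Uq q D).
Notation upi := (upi q D).

Lemma Uq_serre_e i j : i != j -> gserre q D (Ue q D) i j = 0.
Proof.
move=> ij; rewrite -(upi_relator (rel_serre_e q D ij)).
by rewrite (gserre_morph q D _ _ _ (upi_1 q D) (upi_D q D) (upi_M q D) (upi_Z q D)).
Qed.

Lemma Uq_antiautomorphism : exists S : Uq -> Uq,
  [/\ linear S, forall x y, S (x * y) = S y * S x, involutive S,
    (forall j, S (Ue q D j) = Ue q D j) /\ (forall j, S (Uf q D j) = Uf q D j) &
    forall k, S (UK q D k) = UK q D (- k)].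
Proof.
have [g [gP [g1 gM] [ge gf] gK gJ]] :=
  anti_eval (Uq_drinfeld q D) Uq_serre_e (@Uq_serre_f F q I P D).
pose S (x : Uq) := g (lrepr x).
have g0 : g 0 = 0 by have := gP (-1) 0 0; rewrite scaler0 addr0 scaleN1r addNr.
have gB x y : g (x - y) = g x - g y.
  by rewrite addrC -scaleN1r gP scaleN1r addrC.
have SE x : S (upi x) = g x.
  apply/eqP; rewrite -subr_eq0 /S -gB; apply/eqP/gJ.
  by apply/upi_eqP; rewrite -upi_surj.
have SP : linear S.
  move=> c x y; rewrite (upi_surj x) (upi_surj y) -upi_Z -upi_D !SE.
  exact: gP.
have SM x y : S (x * y) = S y * S x.
  by rewrite (upi_surj x) (upi_surj y) -upi_M !SE gM.
have Se j : S (Ue q D j) = Ue q D j by rewrite SE ge.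
have Sf j : S (Uf q D j) = Uf q D j by rewrite SE gf.
have SK k : S (UK q D k) = UK q D (- k) by rewrite SE gK.
exists S; split=> // x; rewrite (upi_surj x); move: (lrepr x) => {}x.
pose B : {pred fralg F I P} := fun z => S (S (upi z)) == upi z.
suff /eqP : x \in B by [].
apply: fralg_ind => [|[[j|j]|k]]; rewrite ?unfold_in.
- split=> [|c y z /eqP yB /eqP zB|y z /eqP yB /eqP zB]; apply/eqP.
  + by rewrite SE g1 -[X in S X](upi_1 q D) SE g1.
  + by rewrite upi_D upi_Z !SP yB zB.
  + by rewrite upi_M !SM yB zB.
- by apply/eqP; rewrite -/(Ue q D j) !Se.
- by apply/eqP; rewrite -/(Uf q D j) !Sf.
- by apply/eqP; rewrite -/(UK q D k) !SK opprK.
Qed.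
End UqAnti.

(** * Transport to [U_q(g)] *)

Section Transport.
Variables (F : fieldType) (A : algType F) (M C : lmodType F) (phi : M -> C).
Hypothesis phi_lin : linear phi.
Hypothesis phi_bij : bijective phi.

Lemma phi_inv_linear psi : cancel phi psi -> cancel psi phi -> linear psi.
Proof.
by move=> phiK psiK c x y; apply: (can_inj phiK); rewrite phi_lin !psiK.
Qed.

(** The last clause is what identifies the transported action: a candidate value [v] for [act x u]
    has to be verified only after [phi], that is, modulo the ideal. *)
Lemma left_transport (ac : A -> C -> C) : left_module ac -> exists act : A -> M -> M,
  [/\ left_module act, forall x u, phi (act x u) = ac x (phi u) &
      forall x u v, phi v = ac x (phi u) -> act x u = v].
Proof.
case=> ll lr l1 lM; have [psi phiK psiK] := phi_bij.
have psi_lin := phi_inv_linear phiK psiK.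
exists (fun x u => psi (ac x (phi u))); split=> [|x u|x u v <-].
- split=> [u c x y|x c u v|u|x y u].
  + by rewrite ll psi_lin.
  + by rewrite phi_lin lr psi_lin.
  + by rewrite l1 phiK.
  + by rewrite lM psiK.
- by rewrite psiK.
- by rewrite phiK.
Qed.

Lemma right_transport (ac : C -> A -> C) : right_module ac -> exists act : M -> A -> M,
  [/\ right_module act, forall x u, phi (act u x) = ac (phi u) x &
      forall x u v, phi v = ac (phi u) x -> act u x = v].
Proof.
case=> ll lr l1 lM; have [psi phiK psiK] := phi_bij.
have psi_lin := phi_inv_linear phiK psiK.
exists (fun u x => psi (ac (phi u) x)); split=> [|x u|x u v <-].
- split=> [x c u v|u c x y|u|u x y].
  + by rewrite phi_lin ll psi_lin.
  + by rewrite lr psi_lin.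
  + by rewrite l1 phiK.
  + by rewrite lM psiK.
- by rewrite psiK.
- by rewrite phiK.
Qed.
End Transport.

Lemma inj_surj_bijective (X Y : Type) (g : X -> Y) :
  injective g -> (forall y, exists x, g x = y) -> bijective g.
Proof.
move=> gI gS; exists (fun y => projT1 (cid (gS y))) => [x|y].
  by apply: gI; case: cid.
by case: cid.
Qed.

Section Assembly.
Variables (F : fieldType) (q : F).
Variables (I : choiceType) (P : zmodType) (D : cartan_datum I P).
Hypothesis q0 : q != 0.
Hypothesis q1 : forall n, (0 < n)%N -> q ^+ n != 1.
Variable i : I.
Notation Uq := (Uq q D).
Notation Ue := (Ue q D).
Notation Uf := (Uf q D).
Notation UK := (UK q D).
Notation Up := (Up q D i).
Notation Upm := (gen_subalg (@p_gen F q I P D i)).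
Notation idl := (p_ideal Ue Uf UK i).
Notation idr := (p_ideal_r Ue Uf UK i).

Lemma Up_valD (x y : Up) : subalg_val (x + y) = subalg_val x + subalg_val y.
Proof. by []. Qed.
Lemma Up_valB (x y : Up) : subalg_val (x - y) = subalg_val x - subalg_val y.
Proof. by []. Qed.
Lemma Up_valM (x y : Up) : subalg_val (x * y) = subalg_val x * subalg_val y.
Proof. by []. Qed.
Lemma Up_val_inj (x y : Up) : subalg_val x = subalg_val y -> x = y.
Proof. exact: val_inj. Qed.

Lemma p_ann_val (v : Up) : p_ann v -> par_ann Ue Uf UK i (subalg_val v).
Proof.
case=> [->|->|[k ->]]; [constructor 1|constructor 2|constructor 3] => //.
by exists k.
Qed.

Lemma p_ann_lift z : par_ann Ue Uf UK i z ->
  exists2 v : Up, p_ann v & subalg_val v = z.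
Proof.
case=> [->|->|[k ->]].
- by exists (pe q D i) => //; constructor 1.
- by exists (pf q D i i) => //; constructor 2.
- by exists (pK q D i k - 1) => //; constructor 3; exists k.
Qed.

(** The bridge between [V_i(0)], built over the subalgebra as a type, and the membership statements
    proved inside [U_q(g)]; multipliers and generators are lifted term by term. *)
Lemma left_idealE (v : Up) :
  (v \in left_ideal (@p_ann F q I P D i)) = (subalg_val v \in idl).
Proof.
apply/idP/idP => [/asboolP[s sP ->]|/asboolP[s sP vE]].
  apply/asboolP; exists [seq (subalg_val p.1, subalg_val p.2) | p <- s].
    move=> _ /mapP[p /sP pA ->]; split; last exact: p_ann_val.
    exact: valP.
  by rewrite big_map (big_morph _ Up_valD (erefl _)).
suff [w wJ wE] : exists2 w : Up, w \in left_ideal (@p_ann F q I P D i) &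
    subalg_val w = \sum_(p <- s) p.1 * p.2.
  by rewrite (Up_val_inj (etrans vE (esym wE))).
elim: s {vE} sP => [|p s IH] sP.
  by exists 0; rewrite ?rpred0 ?big_nil.
have [w wJ wE] := IH (fun r rs => sP r (@mem_behead _ (p :: s) r rs)).
have [pU /p_ann_lift[b bA bE]] := sP p (mem_head _ _).
exists (Subalg pU * b + w); last by rewrite big_cons Up_valD wE Up_valM bE.
rewrite rpredD // left_idealMl //; apply/asboolP; exists [:: (1, b)].
  by move=> _ /[!inE]/eqP ->.
by rewrite big_seq1 mul1r.
Qed.

Lemma right_idealE (v : Up) :
  (v \in right_ideal (@p_ann F q I P D i)) = (subalg_val v \in idr).
Proof.
apply/idP/idP => [/asboolP[s sP ->]|/asboolP[s sP vE]].
  apply/asboolP; exists [seq (subalg_val p.1, subalg_val p.2) | p <- s].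
    move=> _ /mapP[p /sP pA ->]; split; last exact: p_ann_val.
    exact: valP.
  by rewrite big_map (big_morph _ Up_valD (erefl _)).
suff [w wJ wE] : exists2 w : Up, w \in right_ideal (@p_ann F q I P D i) &
    subalg_val w = \sum_(p <- s) p.2 * p.1.
  by rewrite (Up_val_inj (etrans vE (esym wE))).
elim: s {vE} sP => [|p s IH] sP.
  by exists 0; rewrite ?rpred0 ?big_nil.
have [w wJ wE] := IH (fun r rs => sP r (@mem_behead _ (p :: s) r rs)).
have [pU /p_ann_lift[b bA bE]] := sP p (mem_head _ _).
exists (b * Subalg pU + w); last by rewrite big_cons Up_valD wE Up_valM bE.
rewrite rpredD // right_idealMr //; apply/asboolP; exists [:: (1, b)].
  by move=> _ /[!inE]/eqP ->.
by rewrite big_seq1 mulr1.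
Qed.

Variable T : {lrmorphism Uq -> Uq}.
Hypothesis hT : is_braid i T.

Lemma T_one : T 1 = 1. Proof. exact: rmorph1. Qed.
Lemma T_linear : linear T. Proof. exact: linearP. Qed.
Lemma T_mul : {morph T : x y / x * y}. Proof. exact: rmorphM. Qed.
Notation dr := (Uq_drinfeld q D).
Notation sf := (@Uq_serre_f F q I P D).
Notation va := (verma_annihilator D q0 q1).

Definition Ui_emb (u : Ui T) : Up := Subalg (Ui_in_Up i u).
Definition iU_emb (u : iU T) : Up := Subalg (iU_in_Up i u).

Lemma Ui_to_Vi0E u : Ui_to_Vi0 i u = lpi (left_ideal (@p_ann F q I P D i)) (Ui_emb u).
Proof. by rewrite /Ui_to_Vi0 /lcyc_gen lact_pi mulr1. Qed.
Lemma iU_to_iV0E u : iU_to_iV0 i u = lpi (right_ideal (@p_ann F q I P D i)) (iU_emb u).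
Proof. by rewrite /iU_to_iV0 /rcyc_gen ract_pi mul1r. Qed.

Lemma Ui_to_Vi0_linear : linear (@Ui_to_Vi0 F q I P D i T).
Proof.
move=> c u v; rewrite !Ui_to_Vi0E -linearP; congr (lpi _ _).
exact: Up_val_inj.
Qed.

Lemma iU_to_iV0_linear : linear (@iU_to_iV0 F q I P D i T).
Proof.
move=> c u v; rewrite !iU_to_iV0E -linearP; congr (lpi _ _).
exact: Up_val_inj.
Qed.

Let Tf := braid_f hT.
Let Tei := braid_ei hT.
Let Tfi := braid_fi hT.

Lemma Uq_Ui_structure : 
  [/\ forall u, u \in Ui_set T -> u \in idl -> u = 0,
      forall x, x \in Upm -> exists2 u, u \in Ui_set T & x - u \in idl
    & forall u, u \in Ui_set T ->
      [/\ ad_f i u \in Ui_set T /\ Uf i * u - ad_f i u \in idl,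
          ad_e i u \in Ui_set T /\ Ue i * u - ad_e i u \in idl,
          forall j, j != i -> Uf j * u \in Ui_set T
        & forall k, UK k * u * UK (- k) \in Ui_set T /\
            UK k * u - UK k * u * UK (- k) \in idl]].
Proof.
exact: (@Ui_structure F q I P D q0 q1 _ Ue Uf UK dr i sf T T_one T_linear T_mul
  (braid_bij hT) (braid_K hT) Tei Tfi Tf va).
Qed.

Lemma Uq_iU_structure : 
  [/\ forall u, u \in iU_set T -> u \in idr -> u = 0,
      forall x, x \in Upm -> exists2 u, u \in iU_set T & x - u \in idr
    & forall u, u \in iU_set T ->
      [/\ ads_f i u \in iU_set T /\ u * Uf i - ads_f i u \in idr,
          ads_e i u \in iU_set T /\ u * Ue i - ads_e i u \in idr,
          forall j, j != i -> u * Uf j \in iU_set T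
        & forall k, UK (- k) * u * UK (- - k) \in iU_set T /\
            u * UK k - UK (- k) * u * UK (- - k) \in idr]].
Proof.
have [S [SP SM SS [Se Sf] SK]] := Uq_antiautomorphism q D.
exact: (@iU_structure F q I P D q0 q1 _ Ue Uf UK dr i sf T T_one T_linear T_mul
  (braid_bij hT) (braid_K hT) Tei Tfi Tf va S SP SM SS Se Sf SK).
Qed.

Lemma Ui_to_Vi0_bij : bijective (@Ui_to_Vi0 F q I P D i T).
Proof.
have [Uinj Usurj _] := Uq_Ui_structure.
apply: inj_surj_bijective => [u v|c].
  rewrite !Ui_to_Vi0E => /lpi_eqP; rewrite left_idealE Up_valB => uvJ.
  apply/val_inj/subr0_eq/Uinj => //.
  by apply: rpredB; exact: valP.
have [u uU uJ] := Usurj _ (valP (lrepr c)); exists (MkUi uU).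
rewrite Ui_to_Vi0E -[RHS]lreprK; apply/esym/lpi_eqP.
by rewrite left_idealE Up_valB.
Qed.

Lemma iU_to_iV0_bij : bijective (@iU_to_iV0 F q I P D i T).
Proof.
have [Uinj Usurj _] := Uq_iU_structure.
apply: inj_surj_bijective => [u v|c].
  rewrite !iU_to_iV0E => /lpi_eqP; rewrite right_idealE Up_valB => uvJ.
  apply/val_inj/subr0_eq/Uinj => //.
  by apply: rpredB; exact: valP.
have [u uU uJ] := Usurj _ (valP (lrepr c)); exists (MkiU uU).
rewrite iU_to_iV0E -[RHS]lreprK; apply/esym/lpi_eqP.
by rewrite right_idealE Up_valB.
Qed.

Lemma Ui_to_Vi0_eq (x : Up) (u v : Ui T) :
  subalg_val x * Ui_val u - Ui_val v \in idl -> Ui_to_Vi0 i v = lact x (Ui_to_Vi0 i u).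
Proof.
move=> xuv; rewrite !Ui_to_Vi0E lact_pi; apply/esym/lpi_eqP.
by rewrite left_idealE Up_valB Up_valM.
Qed.

Lemma iU_to_iV0_eq (x : Up) (u v : iU T) :
  iU_val u * subalg_val x - iU_val v \in idr -> iU_to_iV0 i v = ract (iU_to_iV0 i u) x.
Proof.
move=> xuv; rewrite !iU_to_iV0E ract_pi; apply/esym/lpi_eqP.
by rewrite right_idealE Up_valB Up_valM.
Qed.

Lemma Ui_module : exists act : Up -> Ui T -> Ui T,
    [/\ left_module act,
        [/\ forall u, Ui_val (act (pf q D i i) u) = ad_f i (Ui_val u),
            forall u, Ui_val (act (pe q D i) u) = ad_e i (Ui_val u),
            forall j u, j != i ->
              Ui_val (act (pf q D i j) u) = Uf j * Ui_val u
          & forall k u, Ui_val (act (pK q D i k) u)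
              = UK k * Ui_val u * UK (- k)],
        linear (@Ui_to_Vi0 _ _ _ _ _ i T),
        bijective (@Ui_to_Vi0 _ _ _ _ _ i T)
      & forall x u, Ui_to_Vi0 i (act x u) = lact x (Ui_to_Vi0 i u)].
Proof.
have [act [actM actE actV]] :=
  left_transport Ui_to_Vi0_linear Ui_to_Vi0_bij (lact_module (@p_ann F q I P D i)).
have [_ _ Ustab] := Uq_Ui_structure.
exists act; split=> //; [|exact: Ui_to_Vi0_linear|exact: Ui_to_Vi0_bij].
split=> [u|u|j u ji|k u]; have [fS eS gS kS] := Ustab _ (valP u).
- have [S J] := fS; rewrite (actV _ _ (MkUi S)) //; exact: Ui_to_Vi0_eq.
- have [S J] := eS; rewrite (actV _ _ (MkUi S)) //; exact: Ui_to_Vi0_eq.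
- rewrite (actV _ _ (MkUi (gS j ji))) //; apply: Ui_to_Vi0_eq.
  by rewrite /= subrr; exact: rpred0.
- have [S J] := kS k; rewrite (actV _ _ (MkUi S)) //; exact: Ui_to_Vi0_eq.
Qed.

Lemma iU_module : exists act : iU T -> Up -> iU T,
    [/\ right_module act,
        [/\ forall u, iU_val (act u (pf q D i i)) = ads_f i (iU_val u),
            forall u, iU_val (act u (pe q D i)) = ads_e i (iU_val u),
            forall j u, j != i ->
              iU_val (act u (pf q D i j)) = iU_val u * Uf j
          & forall k u, iU_val (act u (pK q D i k))
              = UK (- k) * iU_val u * UK k],
        linear (@iU_to_iV0 _ _ _ _ _ i T),
        bijective (@iU_to_iV0 _ _ _ _ _ i T)
      & forall x u, iU_to_iV0 i (act u x) = ract (iU_to_iV0 i u) x].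
Proof.
have [act [actM actE actV]] :=
  right_transport iU_to_iV0_linear iU_to_iV0_bij (ract_module (@p_ann F q I P D i)).
have [_ _ Ustab] := Uq_iU_structure.
exists act; split=> //; [|exact: iU_to_iV0_linear|exact: iU_to_iV0_bij].
split=> [u|u|j u ji|k u]; have [fS eS gS kS] := Ustab _ (valP u).
- have [S J] := fS; rewrite (actV _ _ (MkiU S)) //; exact: iU_to_iV0_eq.
- have [S J] := eS; rewrite (actV _ _ (MkiU S)) //; exact: iU_to_iV0_eq.
- rewrite (actV _ _ (MkiU (gS j ji))) //; apply: iU_to_iV0_eq.
  by rewrite /= subrr; exact: p_ideal_r0.
- have := kS k; rewrite opprK => -[S J].
  rewrite (actV _ _ (MkiU S)) //; exact: iU_to_iV0_eq.
Qed.

End Assembly.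

(** * Specialization to [Q(q)] *)

Lemma qvar_neq0 : qvar != 0.
Proof. by rewrite tofrac_eq0 polyX_eq0. Qed.

Lemma qvar_order n : (0 < n)%N -> qvar ^+ n != 1.
Proof.
move=> n0; rewrite /qvar -tofracXn -tofrac1 tofrac_eq.
apply/eqP => /(congr1 (size : {poly rat} -> nat)).
by rewrite size_polyXn size_poly1 => -[] n0'; rewrite n0' in n0.
Qed.

Theorem proposition2p3p10 (I : choiceType) (P : zmodType)
    (D : cartan_datum I P) (i : I) (T : {lrmorphism Uq qvar D -> Uq qvar D})
    (hT : is_braid i T) :
  (exists act : Up qvar D i -> Ui T -> Ui T,
    [/\ left_module act,
        [/\ forall u, Ui_val (act (pf qvar D i i) u) = ad_f i (Ui_val u),
            forall u, Ui_val (act (pe qvar D i) u) = ad_e i (Ui_val u),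
            forall j u, j != i ->
              Ui_val (act (pf qvar D i j) u) = Uf qvar D j * Ui_val u
          & forall k u, Ui_val (act (pK qvar D i k) u)
              = UK qvar D k * Ui_val u * UK qvar D (- k)],
        linear (@Ui_to_Vi0 _ _ _ _ _ i T),
        bijective (@Ui_to_Vi0 _ _ _ _ _ i T)
      & forall x u, Ui_to_Vi0 i (act x u) = lact x (Ui_to_Vi0 i u)])
  /\
  (exists act : iU T -> Up qvar D i -> iU T,
    [/\ right_module act,
        [/\ forall u, iU_val (act u (pf qvar D i i)) = ads_f i (iU_val u),
            forall u, iU_val (act u (pe qvar D i)) = ads_e i (iU_val u),
            forall j u, j != i ->
              iU_val (act u (pf qvar D i j)) = iU_val u * Uf qvar D j
          & forall k u, iU_val (act u (pK qvar D i k))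
              = UK qvar D (- k) * iU_val u * UK qvar D k],
        linear (@iU_to_iV0 _ _ _ _ _ i T),
        bijective (@iU_to_iV0 _ _ _ _ _ i T)
      & forall x u, iU_to_iV0 i (act u x) = ract (iU_to_iV0 i u) x]).
Proof.
split; [exact: (Ui_module qvar_neq0 qvar_order hT)|].
exact: (iU_module qvar_neq0 qvar_order hT).
Qed.
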